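(* Let $G$ and $H$ be countable discrete groups, $R$ a commutative ring with unit, $W$ an $R$-module, $L$ a $\mathrm{res}$-invariant $RG$-submodule of $C(G,W)$ and $M$ a $\mathrm{res}$-invariant $RH$-submodule of $C(H,W)$. If $\varphi:G\to H$ is a coarse equivalence, then we obtain isomorphisms (induced by $D_*(\varphi)$ and $D^*(\varphi)$) $$H_*(\varphi):H_*(G,L)\cong H_*(H,\varphi_*L),\qquad H^*(\varphi):H^*(H,M)\cong H^*(G,\varphi^*M),$$ and, in the topological case (i.e. if $L$ and $M$ are topological $\mathrm{res}$-invariant modules), $$\bar H_*(\varphi):\bar H_*(G,L)\cong\bar H_*(H,\varphi_*L),\qquad\bar H^*(\varphi):\bar H^*(H,M)\cong\bar H^*(G,\varphi^*M).$$
   Context: $\varphi:G\to H$ is a coarse map if it has finite point preimages and for every $S\subseteq G\times G$ with $\{st^{-1}:(s,t)\in S\}$ finite, $\{\varphi(s)\varphi(t)^{-1}:(s,t)\in S\}$ is finite. $\varphi\sim\phi$ means $\{\varphi(x)\phi(x)^{-1}:x\in G\}$ is finite. A coarse map $\varphi$ is a coarse equivalence if there is a coarse map $\psi:H\to G$ with $\psi\circ\varphi\sim\mathrm{id}_G$, $\varphi\circ\psi\sim\mathrm{id}_H$. $C(G,W)$ is the $RG$-module of all functions $G\to W$ with $(g.f)(x)=f(g^{-1}x)$. An $RG$-submodule $L\subseteq C(G,W)$ is $\mathrm{res}$-invariant if $1_A\cdot f\in L$ for all $f\in L$, $A\subseteq G$. Put $\varphi_*(f)(y)=\sum_{\varphi(x)=y}f(x)$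 and $\varphi^*(f)=f\circ\varphi$; $\varphi_*L$ is the smallest $\mathrm{res}$-invariant $RH$-submodule of $C(H,W)$ containing all $\varphi_*(f)$, $f\in L$; $\varphi^*M$ is the smallest $\mathrm{res}$-invariant $RG$-submodule of $C(G,W)$ containing all $\varphi^*(f)$, $f\in M$. $D_n(L)$ is the set of functions $f:G\times G^n\to W$ with $f(\cdot,\vec g)\in L$ for all $\vec g\in G^n$ and $f(\cdot,\vec g)\ne0$ for only finitely many $\vec g$; $D^n(L)$ is defined in the same way without the finiteness condition. With $\delta_n^{(0)}(x,g_1,\dots,g_n)=(g_1^{-1}x,g_2,\dots,g_n)$, $\delta_n^{(i)}(x,g_1,\dots,g_n)=(x,g_1,\dots,g_ig_{i+1},\dots,g_n)$ ($1\le i\le n-1$), $\delta_n^{(n)}(x,g_1,\dots,g_n)=(x,g_1,\dots,g_{n-1})$, the differentials are $d_n=\sum_{i=0}^n(-1)^i(\delta_n^{(i)})_*$ (summation over fibres) on $D_n(L)$ and $d^n=\sum_{i=0}^{n+1}(-1)^i(\delta_{n+1}^{(i)})^*$ (composition) on $D^n(L)$. These complexes are canonically the bar complexes, so $H_n(G,L)=H_n(D_*(L))$, $H^n(G,L)=H^n(D^*(L))$. With $\varphi^n(x,g_1,\dots,g_n)=(\varphi(x_0),\varphi(x_0)\varphi(x_1)^{-1},\dots,\varphi(x_{n-1})\varphi(x_n)^{-1})$, $x_0=x$, $x_i=g_i^{-1}x_{i-1}$, put $D_n(\varphi)=(\varphi^n)_*:D_n(L)\to D_n(\varphi_*L)$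 and $D^n(\varphi)=(\varphi^n)^*:D^n(M)\to D^n(\varphi^*M)$. Topological setting: $R$ is a topological field. A topological $\mathrm{res}$-invariant submodule $L\subseteq C(G,W)$ is a $\mathrm{res}$-invariant submodule with a topological $R$-vector space structure such that $f\mapsto1_A\cdot f$ ($A\subseteq G$) and $f\mapsto g.f$ ($g\in G$) are continuous. Put $Y=\varphi(G)$, choose $X\subseteq G$ with $\varphi|_X:X\to Y$ bijective, enumerate $H=\{h_1,h_2,\dots\}$ with $h_1=e$, put $Y_1=Y$, $Y_j=Y\setminus h_j^{-1}(h_1Y_1\cup\dots\cup h_{j-1}Y_{j-1})$, $X_j=X\cap\varphi^{-1}(Y_j)$. $\varphi_*L$ carries the finest topology such that for all $J\ge1$ the map $\bigoplus_{j=1}^J1_{X_j}\cdot L\to\varphi_*L$, $(f_j)\mapsto\sum_jh_j.\varphi_*(f_j)$, is continuous. $\varphi^*M$ carries the topology making the bijection $\bigoplus_i1_{\varphi(Z_i)}\cdot M\to\varphi^*M$, $(f_i)\mapsto\sum_i1_{Z_i}\cdot\varphi^*(f_i)$, a homeomorphism, where $G=\bigsqcup_iZ_i$ is a finite partition for which there are $g(i)\in G$, $h(i)\in H$ with $g(i)Z_i\subseteq X$ and $\varphi(x)=h(i)\varphi(g(i)x)$ for all $x\in Z_i$, and $Z_1=X$, $g(1)=e$, $h(1)=e$ (such partitions exist). (Subspaces carry subspace topologies, finite sums the product topology.) Both $D_n(L)$ and $D^n(L)$ carry the topology of pointwise convergence: $f_i\to f$ if and only if $f_i(\cdot,\vec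 g)\to f(\cdot,\vec g)$ in $L$ for all $\vec g\in G^n$. $\bar H_n(G,L)=\ker(d_n)/\overline{\mathrm{im}(d_{n+1})}$, $\bar H^n(G,L)=\ker(d^n)/\overline{\mathrm{im}(d^{n-1})}$, and $\bar H_*(\varphi)$, $\bar H^*(\varphi)$ are the maps induced by $D_*(\varphi)$, $D^*(\varphi)$. *)

(* Defs.v *)
From HB Require Import structures.
From mathcomp Require Import all_boot all_order all_algebra.
From mathcomp Require Import finmap.
From mathcomp Require Import boolp classical_sets functions cardinality fsbigop.
From mathcomp Require Import topology.

Set Implicit Arguments.
Unset Strict Implicit.
Unset Printing Implicit Defensive.

Import GRing.Theory.
Local Open Scope classical_set_scope.
Local Open Scope ring_scope.
Local Open Scope quotient_scope.

Section Coarse.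
Variables G H : groupType.

Definition coarse_map (f : G -> H) : Prop :=
  (forall y, finite_set (f @^-1` [set y])) /\
  (forall S : set (G * G),
     finite_set [set (s.1 * s.2^-1)%g | s in S] ->
     finite_set [set (f s.1 * (f s.2)^-1)%g | s in S]).

Definition close_maps (T : Type) (f g : T -> H) : Prop :=
  finite_set (range (fun x => f x * (g x)^-1)%g).

End Coarse.

Definition coarse_equivalence (G H : groupType) (phi : G -> H) : Prop :=
  coarse_map phi /\
  exists psi : H -> G,
    [/\ coarse_map psi, close_maps (psi \o phi) id & close_maps (phi \o psi) id].

Section Submodules.
Variables (R : pzRingType) (V : lmodType R).

Definition elts (S : submodClosed V) : Type := {x : V | x \in S}.

HB.instance Definition _ (S : submodClosed V) := SubChoice.on (elts S).
HB.instance Definition _ (S : submodClosed V) :=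
  [SubChoice_isSubLmodule of elts S by <:].

Definition submod_zmod (B : submodClosed V) : zmodClosed V :=
  HB.pack (GRing.SubmodClosed.sort B)
    (GRing.isZmodClosed.Build V (GRing.SubmodClosed.sort B) (GRing.submod_closedB (submodClosedP B))).

Definition quotmod (B : submodClosed V) : Type := Quotient.quot (submod_zmod B).

Section Quotmod.
Variable B : submodClosed V.

HB.instance Definition _ :=
  GRing.Zmodule.copy (quotmod B) (Quotient.quot (submod_zmod B)).
HB.instance Definition _ :=
  EqQuotient.copy (quotmod B) (Quotient.quot (submod_zmod B)).

Definition quotmod_scale (a : R) (x : quotmod B) : quotmod B :=
  \pi_(quotmod B) (a *: repr x).

Lemma quotmod_eqP (x y : V) :
  reflect (\pi_(quotmod B) x = \pi_(quotmod B) y) (x - y \in B).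
Proof. by rewrite (Quotient.idealrBE (submod_zmod B)); apply: eqP. Qed.

Lemma quotmod_piD (x y : V) :
  \pi_(quotmod B) (x + y) = \pi_(quotmod B) x + \pi_(quotmod B) y.
Proof. exact: (Quotient.pi_add (submod_zmod B)). Qed.

Lemma quotmod_piZ (a : R) (x : V) :
  \pi_(quotmod B) (a *: x) = quotmod_scale a (\pi_(quotmod B) x).
Proof.
by apply/quotmod_eqP; rewrite -scalerBr rpredZ//; apply/quotmod_eqP; rewrite reprK.
Qed.

Fact quotmod_scalerA a b x :
  quotmod_scale a (quotmod_scale b x) = quotmod_scale (a * b) x.
Proof. by rewrite -[x]reprK -(quotmod_piZ b) -!quotmod_piZ scalerA. Qed.

Fact quotmod_scale1r : left_id 1 quotmod_scale.
Proof. by move=> x; rewrite -[x]reprK -quotmod_piZ scale1r. Qed.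

Fact quotmod_scalerDr : right_distributive quotmod_scale +%R.
Proof.
by move=> a x y; rewrite -[x]reprK -[y]reprK -quotmod_piD -!quotmod_piZ scalerDr
  quotmod_piD.
Qed.

Fact quotmod_scalerDl x : {morph quotmod_scale^~ x : a b / a + b}.
Proof.
by move=> a b; rewrite -[x]reprK -!quotmod_piZ scalerDl quotmod_piD.
Qed.

HB.instance Definition _ := GRing.Zmodule_isLmodule.Build R (quotmod B)
  quotmod_scalerA quotmod_scale1r quotmod_scalerDr quotmod_scalerDl.

End Quotmod.

Section Span.
Variable A : set V.

Definition span_pred : {pred V} :=
  mem [set x | forall S : submodClosed V, (forall y, A y -> y \in S) -> x \in S].

Fact span_closed : subsemimod_closed span_pred.
Proof.
split; first split.
- by apply/mem_set => S _; apply: rpred0.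
- by move=> x y /set_mem hx /set_mem hy; apply/mem_set => S hS;
    apply: rpredD; [apply: hx|apply: hy].
- by move=> a x /set_mem hx; apply/mem_set => S hS; apply: rpredZ; apply: hx.
Qed.

HB.instance Definition _ := GRing.isSubmodClosed.Build R V span_pred span_closed.

Definition span : submodClosed V := span_pred.

End Span.

End Submodules.

Section SubSubmodule.
Variables (R : pzRingType) (V : lmodType R) (Z B : submodClosed V).

Definition within_pred : {pred elts Z} := [pred z | \val z \in B].

Fact within_closed : subsemimod_closed within_pred.
Proof.
split; first split.
- by rewrite inE /= rpred0.
- by move=> x y; rewrite !inE /=; apply: rpredD.
- by move=> a x; rewrite !inE /=; apply: rpredZ.
Qed.

HB.instance Definition _ :=
  GRing.isSubmodClosed.Build R (elts Z) within_pred within_closed.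

Definition within_submod : submodClosed (elts Z) := within_pred.

End SubSubmodule.

Section FunctionModules.
Variables (R : pzRingType) (W : lmodType R).

Definition translate (G : groupType) (g : G) (f : G -> W) : G -> W :=
  fun x => f (g^-1 * x)%g.

Definition cut (G : Type) (A : set G) (f : G -> W) : G -> W := patch 0 A f.

Definition pushf (X Y : choiceType) (u : X -> Y) (f : X -> W) : Y -> W :=
  fun y => \sum_(x \in u @^-1` [set y]) f x.

Definition pullf (X Y : Type) (u : X -> Y) (f : Y -> W) : X -> W := f \o u.

Record resModule (G : groupType) : Type := ResModule {
  res_submod :> submodClosed (G -> W);
  translate_in : forall g f, f \in res_submod -> translate g f \in res_submod;
  cut_in : forall A f, f \in res_submod -> cut A f \in res_submod }.

Section Generated.
Variables (G : groupType) (F : set (G -> W)).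

Definition res_span_pred : {pred G -> W} :=
  mem [set f | forall S : resModule G, (forall f', F f' -> f' \in S) -> f \in S].

Fact res_span_closed : subsemimod_closed res_span_pred.
Proof.
split; first split.
- by apply/mem_set => S _; apply: rpred0.
- by move=> x y /set_mem hx /set_mem hy; apply/mem_set => S hS;
    apply: rpredD; [apply: hx|apply: hy].
- by move=> a x /set_mem hx; apply/mem_set => S hS; apply: rpredZ; apply: hx.
Qed.

HB.instance Definition _ :=
  GRing.isSubmodClosed.Build R (G -> W) res_span_pred res_span_closed.

Fact res_span_translate g f : f \in res_span_pred -> translate g f \in res_span_pred.
Proof.
by move=> /set_mem hf; apply/mem_set => S hS; apply: translate_in; apply: hf.
Qed.

Fact res_span_cut A f : f \in res_span_pred -> cut A f \in res_span_pred.
Proof.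
by move=> /set_mem hf; apply/mem_set => S hS; apply: cut_in; apply: hf.
Qed.

(* The smallest res-invariant submodule containing F. *)
Definition res_span : resModule G :=
  @ResModule G res_span_pred res_span_translate res_span_cut.

Lemma res_span_gen f : F f -> f \in res_span.
Proof. by move=> Ff; apply/mem_set => S; apply. Qed.

End Generated.

Section PushPull.
Variables (G H : groupType) (phi : G -> H).

Definition push (L : resModule G) : resModule H :=
  res_span [set pushf phi f | f in [set` L]].

Definition pull (M : resModule H) : resModule G :=
  res_span [set pullf phi f | f in [set` M]].

Fact pushf_in (L : resModule G) f : f \in L -> pushf phi f \in push L.
Proof. by move=> Lf; apply: res_span_gen; exists f. Qed.

Fact pullf_in (M : resModule H) f : f \in M -> pullf phi f \in pull M.
Proof. by move=> Mf; apply: res_span_gen; exists f. Qed.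

Definition rpush (L : resModule G) (f : elts L) : elts (push L) :=
  exist _ (pushf phi (\val f)) (pushf_in (valP f)).

Definition rpull (M : resModule H) (f : elts M) : elts (pull M) :=
  exist _ (pullf phi (\val f)) (pullf_in (valP f)).

End PushPull.

Definition rtranslate (G : groupType) (L : resModule G) (g : G) (f : elts L) :
  elts L := exist _ (translate g (\val f)) (translate_in g (valP f)).

Definition rcut (G : groupType) (L : resModule G) (A : set G) (f : elts L) :
  elts L := exist _ (cut A (\val f)) (cut_in A (valP f)).

Section Complexes.
Variable G : groupType.

(* G x G^n; g_i is nth 1 g (i-1). *)
Definition cell (n : nat) : Type := (G * n.-tuple G)%type.

HB.instance Definition _ n := Choice.on (cell n).

(* The face delta_(n+1)^(i), 0 <= i <= n+1. The tuple is given by one formula: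
   i = 0 removes g_1, i = n+1 removes g_(n+1), otherwise g_i and g_(i+1) are
   multiplied. *)
Definition face (n i : nat) (p : cell n.+1) : cell n :=
  let g k := nth 1%g p.2 k in
  (if i == 0%N then ((g 0%N)^-1 * p.1)%g else p.1,
   [tuple if (j.+1 < i)%N then g j
          else if j.+1 == i :> nat then (g j * g j.+1)%g
          else g j.+1 | j < n]).

Definition slice n (f : cell n -> W) (g : n.-tuple G) : G -> W :=
  fun x => f (x, g).

(* There are no chains in degree -1, hence the zero map in degree 0. *)
Definition bd (n : nat) : (cell n -> W) -> (cell n.-1 -> W) :=
  match n with
  | 0 => fun=> 0
  | m.+1 => fun f => \sum_(i < m.+2) (-1) ^+ i *: pushf (@face m i) f
  end.

Definition cobd (n : nat) (f : cell n -> W) : cell n.+1 -> W :=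
  \sum_(i < n.+2) (-1) ^+ i *: pullf (@face n i) f.

Section Fixed.
Variable L : resModule G.

Definition cochain_pred n : {pred cell n -> W} :=
  mem [set f | forall g, slice f g \in L].

Fact cochain_closed n : subsemimod_closed (@cochain_pred n).
Proof.
split; first split.
- by apply/mem_set => g; apply: rpred0.
- move=> f1 f2 /set_mem h1 /set_mem h2; apply/mem_set => g.
  exact: (rpredD (h1 g) (h2 g)).
- move=> a f /set_mem h; apply/mem_set => g; exact: (rpredZ a (h g)).
Qed.

HB.instance Definition _ n :=
  GRing.isSubmodClosed.Build R (cell n -> W) (@cochain_pred n) (@cochain_closed n).

Definition cochains n : submodClosed (cell n -> W) := @cochain_pred n.

Definition chain_pred n : {pred cell n -> W} :=
  mem [set f | f \in cochains n /\ finite_set [set g | slice f g <> 0]].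

Fact chain_closed n : subsemimod_closed (@chain_pred n).
Proof.
split; first split.
- by apply/mem_set; split; [apply: rpred0|apply: sub_finite_set (finite_set0 _) => g /=].
- move=> f1 f2 /set_mem[h1 k1] /set_mem[h2 k2]; apply/mem_set; split.
    exact: rpredD.
  apply: (sub_finite_set _ (_ : finite_set ([set g | slice f1 g <> 0] `|`
    [set g | slice f2 g <> 0]))); last by rewrite finite_setU.
  move=> g /= ne; have [e1|] := pselect (slice f1 g = 0); last by left.
  right=> e2; apply: ne; apply/funext => x.
  by have := congr1 (@^~ x) e1; have := congr1 (@^~ x) e2; rewrite /slice /=
    => e2x e1x; rewrite [LHS]/(f1 (x, g) + f2 (x, g)) e1x e2x; exact: addr0.
- move=> a f /set_mem[h k]; apply/mem_set; split; first exact: rpredZ.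
  apply: sub_finite_set k => g /= ne e; apply: ne; apply/funext => x.
  by have := congr1 (@^~ x) e; rewrite /slice /= => ex;
    rewrite [LHS]/(a *: f (x, g)) ex; exact: scaler0.
Qed.

HB.instance Definition _ n :=
  GRing.isSubmodClosed.Build R (cell n -> W) (@chain_pred n) (@chain_closed n).

Definition chains n : submodClosed (cell n -> W) := @chain_pred n.

End Fixed.
End Complexes.
End FunctionModules.

Section Homology.
Variables (R : pzRingType) (W : lmodType R) (G : groupType).

Lemma pushf_linear (X Y : choiceType) (u : X -> Y) (a : R) (f1 f2 : X -> W) :
  (forall y, finite_set [set x | u x = y /\ f1 x <> 0]) ->
  (forall y, finite_set [set x | u x = y /\ f2 x <> 0]) ->
  pushf u (a *: f1 + f2) = a *: pushf u f1 + pushf u f2.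
Proof.
move=> fin1 fin2; apply/funext => y.
pose D := [set x | u x = y /\ f1 x <> 0] `|` [set x | u x = y /\ f2 x <> 0].
have finD : finite_set D by rewrite finite_setU.
have sumE (f : X -> W) : (forall x, u x = y -> ~ D x -> f x = 0) ->
    pushf u f y = \sum_(x <- fset_set D) f x.
  move=> f0; rewrite -fsbig_finite//; apply/esym/fsbig_widen => x.
    by case=> -[].
  by case=> /= uxy nDx; apply: f0.
have D1 x : u x = y -> ~ D x -> f1 x = 0.
  by move=> uxy nDx; apply: contrapT => ne; apply: nDx; left.
have D2 x : u x = y -> ~ D x -> f2 x = 0.
  by move=> uxy nDx; apply: contrapT => ne; apply: nDx; right.
suff : pushf u (a *: f1 + f2) y = a *: pushf u f1 y + pushf u f2 y by [].
rewrite !sumE//.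
  by rewrite scaler_sumr -big_split.
move=> x uxy nDx; suff : a *: f1 x + f2 x = 0 by [].
by rewrite D1// D2// addr0 scaler0.
Qed.

Variable L : resModule W G.

Lemma face_fin m i (f : cell G m.+1 -> W) (y : cell G m) :
  f \in chains L m.+1 -> finite_set [set p | face i p = y /\ f p <> 0].
Proof.
move=> /set_mem[_ fin].
pose h (g : m.+1.-tuple G) : cell G m.+1 :=
  (if i == 0%N then (nth 1 g 0 * y.1)%g else y.1, g).
apply: sub_finite_set (finite_image h fin) => -[x g] /= [eqy fxg].
exists g; first by move=> /(congr1 (@^~ x)).
by rewrite /h/= -eqy/=; case: (i == 0%N); rewrite ?mulVKg.
Qed.

Lemma bd_linear n a (f1 f2 : cell G n -> W) :
  f1 \in chains L n -> f2 \in chains L n ->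
  bd (a *: f1 + f2) = a *: bd f1 + bd f2.
Proof.
case: n f1 f2 => [|m] f1 f2 h1 h2 /=; first by rewrite scaler0 addr0.
rewrite scaler_sumr -big_split; apply: eq_bigr => i _ /=.
rewrite pushf_linear; [|by move=> y; exact: face_fin..].
by rewrite scalerDr !scalerA; congr (_ *: _ + _); rewrite -signr_odd;
  case: (odd i); rewrite ?expr0 ?expr1 ?mulr1 ?mul1r// mulrN1 mulN1r.
Qed.

Lemma bd0 n : @bd R W G n 0 = 0.
Proof.
have := @bd_linear n (-1) 0 0 (rpred0 _) (rpred0 _).
by rewrite scaler0 addr0 scaleN1r addNr.
Qed.

Lemma cobd_linear n a (f1 f2 : cell G n -> W) :
  cobd (a *: f1 + f2) = a *: cobd f1 + cobd f2.
Proof.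
rewrite /cobd scaler_sumr -big_split; apply: eq_bigr => i _ /=.
rewrite [pullf _ _]/(a *: pullf (face i) f1 + pullf (face i) f2).
by rewrite scalerDr !scalerA; congr (_ *: _ + _); rewrite -signr_odd;
  case: (odd i); rewrite ?expr0 ?expr1 ?mulr1 ?mul1r// mulrN1 mulN1r.
Qed.

Definition cycle_pred n : {pred cell G n -> W} :=
  mem [set f | f \in chains L n /\ bd f = 0].

Fact cycle_closed n : subsemimod_closed (@cycle_pred n).
Proof.
suff lin a f1 f2 : f1 \in @cycle_pred n -> f2 \in @cycle_pred n ->
    a *: f1 + f2 \in @cycle_pred n.
  have z : 0 \in @cycle_pred n.
    apply/mem_set; split; first exact: rpred0.
    exact: bd0.
  split; first split=> //.
    by move=> x y hx hy; have := lin 1 _ _ hx hy; rewrite scale1r.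
  by move=> a x hx; have := lin a _ _ hx z; rewrite addr0.
move=> /set_mem[h1 k1] /set_mem[h2 k2]; apply/mem_set; split.
  by apply: rpredD => //; apply: rpredZ.
by rewrite bd_linear// k1 k2 scaler0 addr0.
Qed.

HB.instance Definition _ n :=
  GRing.isSubmodClosed.Build R (cell G n -> W) (@cycle_pred n) (@cycle_closed n).

Definition cycles n : submodClosed (cell G n -> W) := @cycle_pred n.

Definition boundary_pred n : {pred cell G n -> W} :=
  mem [set @bd R W G n.+1 f | f in [set` chains L n.+1]].

Fact boundary_closed n : subsemimod_closed (@boundary_pred n).
Proof.
suff lin a f1 f2 : f1 \in @boundary_pred n -> f2 \in @boundary_pred n ->
    a *: f1 + f2 \in @boundary_pred n.
  have z : 0 \in @boundary_pred n.
    apply/mem_set; exists 0; first exact: (rpred0 (chains L n.+1)).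
    exact: bd0.
  split; first split=> //.
    by move=> x y hx hy; have := lin 1 _ _ hx hy; rewrite scale1r.
  by move=> a x hx; have := lin a _ _ hx z; rewrite addr0.
move=> /set_mem[g1 h1 <-] /set_mem[g2 h2 <-]; apply/mem_set.
exists (a *: g1 + g2); last exact: bd_linear.
by apply: rpredD => //; apply: rpredZ.
Qed.

HB.instance Definition _ n :=
  GRing.isSubmodClosed.Build R (cell G n -> W) (@boundary_pred n)
    (@boundary_closed n).

Definition boundaries n : submodClosed (cell G n -> W) := @boundary_pred n.

Definition cocycle_pred n : {pred cell G n -> W} :=
  mem [set f | f \in cochains L n /\ cobd f = 0].

Fact cobd0 n : @cobd R W G n 0 = 0.
Proof.
by have := @cobd_linear n (-1) 0 0; rewrite scaler0 addr0 scaleN1r addNr.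
Qed.

Fact cocycle_closed n : subsemimod_closed (@cocycle_pred n).
Proof.
split; first split.
- by apply/mem_set; split; [exact: rpred0|exact: cobd0].
- move=> f1 f2 /set_mem[h1 k1] /set_mem[h2 k2]; apply/mem_set.
  split; first exact: rpredD.
  by have := @cobd_linear n 1 f1 f2; rewrite !scale1r k1 k2 addr0.
- move=> a f /set_mem[h k]; apply/mem_set; split; first exact: rpredZ.
  by have := @cobd_linear n a f 0; rewrite !addr0 k cobd0 scaler0 addr0.
Qed.

HB.instance Definition _ n :=
  GRing.isSubmodClosed.Build R (cell G n -> W) (@cocycle_pred n)
    (@cocycle_closed n).

Definition cocycles n : submodClosed (cell G n -> W) := @cocycle_pred n.

Definition coboundary_pred n : {pred cell G n -> W} :=
  mem (match n return set (cell G n -> W) with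
       | 0 => [set 0]
       | m.+1 => [set cobd f | f in [set` cochains L m]]
       end).

Fact coboundary_closed n : subsemimod_closed (@coboundary_pred n).
Proof.
case: n => [|m]; split; first split.
- exact/mem_set.
- by move=> _ _ /set_mem-> /set_mem->; rewrite addr0; apply/mem_set.
- by move=> a _ /set_mem->; rewrite scaler0; apply/mem_set.
- split; first by apply/mem_set; exists 0; [exact: (rpred0 (cochains L m))|exact: cobd0].
  move=> _ _ /set_mem[f1 h1 <-] /set_mem[f2 h2 <-]; apply/mem_set.
  exists (f1 + f2); first by apply: (rpredD h1 h2).
  by have := @cobd_linear m 1 f1 f2; rewrite !scale1r.
- move=> a _ /set_mem[f h <-]; apply/mem_set; exists (a *: f).
    exact: (rpredZ a h).
  by have := @cobd_linear m a f 0; rewrite !addr0 cobd0 addr0.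
Qed.

HB.instance Definition _ n :=
  GRing.isSubmodClosed.Build R (cell G n -> W) (@coboundary_pred n)
    (@coboundary_closed n).

Definition coboundaries n : submodClosed (cell G n -> W) := @coboundary_pred n.

Definition homology n : lmodType R := quotmod (within_submod (cycles n) (boundaries n)).

Definition cohomology n : lmodType R :=
  quotmod (within_submod (cocycles n) (coboundaries n)).

End Homology.

Section Induced.
Variables (G H : groupType) (phi : G -> H).

(* The points x_0 = x, x_i = g_i^-1 x_(i-1). *)
Fixpoint vertex (x : G) (g : nat -> G) (i : nat) : G :=
  if i is k.+1 then ((g k)^-1 * vertex x g k)%g else x.

Definition cell_map (n : nat) (p : cell G n) : cell H n :=
  let x := vertex p.1 (nth 1%g p.2) in
  (phi (x 0%N), [tuple (phi (x i) * (phi (x i.+1))^-1)%g | i < n]).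

Section Maps.
Variables (R : pzRingType) (W : lmodType R).

Definition chain_map (n : nat) (f : cell G n -> W) : cell H n -> W :=
  pushf (@cell_map n) f.

Definition cochain_map (n : nat) (f : cell H n -> W) : cell G n -> W :=
  pullf (@cell_map n) f.

End Maps.
End Induced.

(* F maps the submodule Z of V to the submodule Z' of V', and h is the map that F
   induces from Z/B to Z'/B'. *)
Definition induced_by (R : pzRingType) (V V' : lmodType R)
    (Z : submodClosed V) (Z' : submodClosed V')
    (B : submodClosed (elts Z)) (B' : submodClosed (elts Z'))
    (F : V -> V') (h : quotmod B -> quotmod B') : Prop :=
  forall z : elts Z, exists2 z' : elts Z',
    \val z' = F (\val z) & h (\pi_(quotmod B) z) = \pi_(quotmod B') z'.

Definition topologized (T : Type) (t : Topological T) : topologicalType :=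
  Topological.Pack t.

Section FinalTopology.
Variables (I : Type) (S : I -> topologicalType).

Definition final_topology (T : Type) (s : forall i, S i -> T) : Type := T.

Variables (T : choiceType) (s : forall i, S i -> T).

Definition final_open : set_system T :=
  [set U | forall i, open (@s i @^-1` U)].

Fact final_openT : final_open setT.
Proof. by move=> i; exact: openT. Qed.

Fact final_openI : setI_closed final_open.
Proof. by move=> A B hA hB i; apply: openI; [apply: hA|apply: hB]. Qed.

Fact final_open_bigU (J : Type) (f : J -> set T) :
  (forall j, final_open (f j)) -> final_open (\bigcup_j f j).
Proof. by move=> hf i; rewrite preimage_bigcup; apply: bigcup_open => j _; apply: hf. Qed.

HB.instance Definition _ := Choice.on (final_topology s).
HB.instance Definition _ := isOpenTopological.Build (final_topology s)
  final_openT final_openI final_open_bigU.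

End FinalTopology.

Definition homeomorphism (S T : topologicalType) (f : S -> T) : Prop :=
  exists f' : T -> S,
    [/\ cancel f f', cancel f' f, continuous f & continuous f'].

Definition topological_field (R : fieldType) (tR : Topological R) : Prop :=
  let K := topologized tR in
  [/\ continuous (fun x : K * K => (x.1 : R) + (x.2 : R) : K),
      continuous (fun x : K * K => (x.1 : R) * (x.2 : R) : K),
      continuous (fun x : K => - (x : R) : K) &
      forall x : K, (x : R) != 0 ->
        {for x, continuous (fun y : K => (y : R)^-1 : K)}].

Section TopologicalModules.
Variables (R : fieldType) (tR : Topological R) (W : lmodType R).

Definition topological_vector_space (V : lmodType R) (t : Topological V) : Prop :=
  let K := topologized tR in let E := topologized t in
  continuous (fun x : E * E => (x.1 : V) + (x.2 : V) : E) /\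
  continuous (fun x : K * E => (x.1 : R) *: (x.2 : V) : E).

Definition topological_resModule (G : groupType) (L : resModule W G)
    (t : Topological (elts L)) : Prop :=
  let E := topologized t in
  [/\ topological_vector_space t,
      forall A, continuous (rcut A : E -> E) &
      forall g, continuous (rtranslate g : E -> E)].

End TopologicalModules.

Section ReducedHomology.
Variables (R : pzRingType) (W : lmodType R).

(* Pointwise convergence for a module of functions on G x G^n with slices in L:
   the initial topology for f |-> (slice f g)_g in the product of copies of L. *)
Section Pointwise.
Variables (G : groupType) (L : resModule W G) (tL : Topological (elts L)).
Variables (n : nat) (S : submodClosed (cell G n -> W)).
Hypothesis SL : forall f, f \in S -> f \in cochains L n.

Fact slice_in (f : elts S) g : slice (\val f) g \in L.
Proof. by have /set_mem := SL (valP f); apply. Qed.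

Definition slices (f : elts S) :
    prod_topology (fun _ : n.-tuple G => topologized tL) :=
  fun g => exist _ (slice (\val f) g) (slice_in f g).

Definition pointwise_topology : Topological (elts S) :=
  Topological.class (initial_topology slices).

End Pointwise.

Section ReducedQuotient.
Variables (V : lmodType R) (t : Topological V) (B : submodClosed V).

Definition closure_submod : submodClosed V :=
  span (closure ([set` B] : set (topologized t))).

Definition quotient_class : Topological (quotmod closure_submod) :=
  Topological.class (@quotient_topology (topologized t) (quotmod closure_submod)).

End ReducedQuotient.

Section Reduced.
Variables (G : groupType) (L : resModule W G) (tL : Topological (elts L)).

Fact cycles_cochains n f : f \in cycles L n -> f \in cochains L n.
Proof. by move=> /set_mem[/set_mem[]]. Qed.

Fact cocycles_cochains n f : f \in cocycles L n -> f \in cochains L n.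
Proof. by move=> /set_mem[]. Qed.

Definition cycles_topology n : Topological (elts (cycles L n)) :=
  pointwise_topology tL (@cycles_cochains n).

Definition cocycles_topology n : Topological (elts (cocycles L n)) :=
  pointwise_topology tL (@cocycles_cochains n).

Definition reduced_homology n : lmodType R :=
  quotmod (closure_submod (cycles_topology n)
    (within_submod (cycles L n) (boundaries L n))).

Definition reduced_homology_topology n : Topological (reduced_homology n) :=
  quotient_class _ _.

Definition reduced_cohomology n : lmodType R :=
  quotmod (closure_submod (cocycles_topology n)
    (within_submod (cocycles L n) (coboundaries L n))).

Definition reduced_cohomology_topology n : Topological (reduced_cohomology n) :=
  quotient_class _ _.

End Reduced.
End ReducedHomology.

Section ClosureSubmod.
Variables (R : fieldType) (tR : Topological R) (V : lmodType R) (t : Topological V).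
Variable B : submodClosed V.

(* The linear span in closure_submod only serves to have a quotient module for every
   topology t: for a vector space topology it adds nothing to the closure. *)
Lemma closure_submodE : topological_vector_space tR t ->
  forall x, (x \in closure_submod t B) <-> closure ([set` B] : set (topologized t)) x.
Proof.
move=> [addC scaleC] x; split; last first.
  by move=> clx; apply/mem_set => S; apply.
set E := topologized t; set C := closure _.
have clD (y z : V) : C y -> C z -> C (y + z).
  move=> Cy Cz U /(addC (y, z)) [[U1 U2] /= [nU1 nU2] sU].
  have [a [Ba Ua]] := Cy _ nU1; have [b [Bb Ub]] := Cz _ nU2.
  by exists (a + b); split; [exact: (rpredD Ba Bb)|exact: (sU (a, b))].
have clZ (a : R) (y : V) : C y -> C (a *: y).
  move=> Cy U /(scaleC (a, y)) [[U1 U2] /= [nU1 nU2] sU].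
  have [b [Bb Ub]] := Cy _ nU2.
  exists (a *: b); split; first exact: (rpredZ a Bb).
  have U1a := @nbhs_singleton (topologized tR) _ _ nU1.
  exact: (sU (a, b) (conj U1a Ub)).
pose P : {pred V} := mem C.
have Pc : subsemimod_closed P.
  split; first split.
  - by apply/mem_set; apply: subset_closure; exact: (rpred0 B).
  - by move=> y z /set_mem hy /set_mem hz; apply/mem_set; exact: clD.
  - by move=> a y /set_mem hy; apply/mem_set; exact: clZ.
pose S : submodClosed V := HB.pack P (GRing.isSubmodClosed.Build R V P Pc).
by move=> /set_mem /(_ S) h; apply/set_mem/h => y Cy; exact/mem_set.
Qed.
End ClosureSubmod.

Section PointwiseTVS.
Variables (R : fieldType) (tR : Topological R) (W : lmodType R).
Variables (G : groupType) (L : resModule W G) (tL : Topological (elts L)).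
Variables (n : nat) (S : submodClosed (cell G n -> W)).
Hypothesis SL : forall f, f \in S -> f \in cochains L n.

Lemma pointwise_continuous (X : topologicalType)
    (f : X -> topologized (pointwise_topology tL SL)) :
  (forall g, continuous (fun x => slices tL SL (f x) g : topologized tL)) ->
  continuous f.
Proof.
move=> cf; apply: (@continuous_comp_initial _ X _ (slices tL SL) f) => x.
apply/cvg_sup => g.
apply: (@continuous_comp_initial _ X _ (fun u : n.-tuple G -> topologized tL => u g)
  (slices tL SL \o f)).
exact: cf.
Qed.

Lemma slices_continuous g :
  continuous (fun f : topologized (pointwise_topology tL SL) =>
    slices tL SL f g : topologized tL).
Proof.
move=> f; apply: (@cvg_comp _ _ _ (slices tL SL) (fun u => u g)).
  exact: (@initial_continuous _ _ (slices tL SL) f).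
exact: proj_continuous.
Qed.

Lemma pointwise_tvs : topological_vector_space tR tL ->
  topological_vector_space tR (pointwise_topology tL SL).
Proof.
move=> [addC scaleC]; set E := topologized (pointwise_topology tL SL).
have sc g (T : topologicalType) (f : T -> E) : continuous f ->
    continuous (fun x => slices tL SL (f x) g : topologized tL).
  move=> cf x; exact: (@continuous_comp T E (topologized tL) f
    (fun u : E => slices tL SL u g : topologized tL) x (cf x)
    (@slices_continuous g (f x))).
split; apply: pointwise_continuous => g x.
- pose u (y : E * E) : topologized tL * topologized tL :=
    (slices tL SL y.1 g, slices tL SL y.2 g).
  rewrite (_ : (fun _ => _) = (fun y => ((u y).1 : elts L) + ((u y).2 : elts L)));
    last by apply/funext => y; apply: val_inj.
  have cu : {for x, continuous u}.
    by apply: cvg_pair; apply: (sc g _ _ _ x) => y; [exact: cvg_fst|exact: cvg_snd].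
  exact: (@continuous_comp _ _ (topologized tL) u _ x cu (addC (u x))).
- pose u (y : topologized tR * E) : topologized tR * topologized tL :=
    (y.1, slices tL SL y.2 g).
  rewrite (_ : (fun _ => _) = (fun y => ((u y).1 : R) *: ((u y).2 : elts L)));
    last by apply/funext => y; apply: val_inj.
  have cu : {for x, continuous u}.
    apply: cvg_pair; first exact: cvg_fst.
    by apply: (sc g _ _ _ x) => y; exact: cvg_snd.
  exact: (@continuous_comp _ _ (topologized tL) u _ x cu (scaleC (u x))).
Qed.
End PointwiseTVS.
Section PushPullTopology.
Variables (R : pzRingType) (W : lmodType R) (G H : groupType) (phi : G -> H).

Definition lmulset (K : groupType) (k : K) (A : set K) : set K :=
  [set (k * a)%g | a in A].

(* 1_A . L with the subspace topology *)
Definition piece (K : groupType) (L : resModule W K) (tL : Topological (elts L))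
    (A : set K) : topologicalType :=
  set_type (range (rcut A) : set (topologized tL)).

(* Indices are shifted by one: h 0, h 1, ... stand for h_1, h_2, ...
   covered h j is the union of h_i Y_i over i < j. *)
Fixpoint covered (h : nat -> H) (j : nat) : set H :=
  if j is i.+1 then
    covered h i `|`
      lmulset (h i) (range phi `\` lmulset (h i)^-1%g (covered h i))
  else set0.

Definition Ypart (h : nat -> H) (j : nat) : set H :=
  range phi `\` lmulset (h j)^-1%g (covered h j).

Definition Xpart (X : set G) (h : nat -> H) (j : nat) : set G :=
  X `&` phi @^-1` Ypart h j.

Section PushTopology.
Variables (L : resModule W G) (tL : Topological (elts L)).
Variables (X : set G) (h : nat -> H).

Definition push_sum (J : nat)
    (f : prod_topology (fun j : 'I_J.+1 => piece tL (Xpart X h j))) :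
    elts (push phi L) :=
  \sum_(j < J.+1) rtranslate (h j) (rpush phi (\val (f j) : elts L)).

Definition push_topology : Topological (elts (push phi L)) :=
  Topological.class (final_topology push_sum).

End PushTopology.

Section PullTopology.
Variables (M : resModule W H) (tM : Topological (elts M)).
Variables (N : nat) (Z : 'I_N.+1 -> set G).

Definition pull_sum
    (f : prod_topology (fun i : 'I_N.+1 => piece tM (phi @` Z i))) :
    elts (pull phi M) :=
  \sum_(i < N.+1) rcut (Z i) (rpull phi (\val (f i) : elts M)).

(* pull_sum is a bijection, so the final topology for this one map is the topology
   for which it is a homeomorphism. *)
Definition pull_topology : Topological (elts (pull phi M)) :=
  Topological.class (final_topology (fun _ : unit => pull_sum)).

End PullTopology.

Definition enumeration (h : nat -> H) : Prop := h 0%N = 1%g /\ range h = setT.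

Definition section_of (X : set G) : Prop := set_bij X (range phi) phi.

Definition adapted_partition (X : set G) (N : nat) (Z : 'I_N.+1 -> set G)
    (g : 'I_N.+1 -> G) (k : 'I_N.+1 -> H) : Prop :=
  [/\ trivIset setT Z, \bigcup_i Z i = setT,
      [/\ Z ord0 = X, g ord0 = 1%g & k ord0 = 1%g] &
      forall i x, Z i x -> X (g i * x)%g /\ phi x = (k i * phi (g i * x))%g].

End PushPullTopology.

(* Main.v *)
(* A cell (x, g_1, ..., g_n) is the tuple (x_0, ..., x_n) of its vertices x_0 = x,
   x_i = g_i^-1 x_(i-1). In these coordinates the faces delete a vertex and phi^n is
   phi applied to every vertex, so D_*(phi) and D^*(phi) commute with the differentials,
   and a map theta at finite distance from id induces a map homotopic to the identity
   through the prisms (x_0, ..., x_j, theta x_j, ..., theta x_n).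

   Let psi be a coarse inverse of phi. Since psi phi is close to id, psi_* maps phi_* L
   back into L, and psi^* maps phi^* M back into M; so psi induces the inverses in
   homology and cohomology. In the topological case a map close to id acts on L as a
   finite sum of translates of restrictions, hence continuously. The universal property
   of the final topologies on phi_* L and phi^* M then makes psi_* and psi^* continuous,
   while phi_* and phi^* factor continuously through the maps that define these
   topologies. As the slices of D_n(phi) f and D^n(phi) f are finite sums of images of
   restricted slices of f, the maps on cycles and cocycles are continuous in both
   directions, and the induced maps on the reduced groups are homeomorphisms. The
   differentials and the prism homotopy need not be continuous. *)

Require Import Defs.
From HB Require Import structures.
From mathcomp Require Import all_boot all_order all_algebra.
From mathcomp Require Import finmap.
From mathcomp Require Import boolp classical_sets functions cardinality fsbigop.
From mathcomp Require Import topology zify.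

Set Implicit Arguments.
Unset Strict Implicit.
Unset Printing Implicit Defensive.

Local Open Scope classical_set_scope.
Local Open Scope ring_scope.

Import GRing.Theory.

Lemma finite_set_seq (T : choiceType) (A : set T) :
  finite_set A -> exists2 s : seq T, uniq s & forall x, A x -> x \in s.
Proof.
move=> finA; exists (fset_set A); first exact: fset_uniq.
by move=> x Ax; rewrite in_fset_set// inE.
Qed.

(** * Sums over fibres *)

Section PushSums.
Variables (R : pzRingType) (W : lmodType R).

Lemma cutE (T : Type) (A : set T) (f : T -> W) x :
  cut A f x = if x \in A then f x else 0.
Proof. by []. Qed.

(** [pushf] sums over a fibre, with value 0 when the support there is infinite. Any duplicate-free
    list containing that support computes it, and sums over lists are easy to exchange. *)
Lemma pushfE (X Y : choiceType) (u : X -> Y) (f : X -> W) (y : Y) (r : seq X) :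
  uniq r -> (forall x, u x = y -> f x <> 0 -> x \in r) ->
  pushf u f y = \sum_(x <- r | u x == y) f x.
Proof.
move=> ur rP; rewrite /pushf -[RHS]big_filter.
rewrite [RHS]fsbig_seq ?filter_uniq//; apply/esym/fsbig_widen => x /=.
  by rewrite mem_filter => /andP[/eqP].
move=> [uxy]; rewrite mem_filter uxy eqxx/= => xr.
by apply: contrapT => fx0; apply: xr; exact: rP.
Qed.

Lemma pushf_eq0 (X Y : choiceType) (u : X -> Y) (f : X -> W) (y : Y) :
  (forall x, u x = y -> f x = 0) -> pushf u f y = 0.
Proof.
by move=> f0; rewrite (@pushfE _ _ _ _ _ [::])// => [|x /f0//]; rewrite big_nil.
Qed.

(** A rearrangement of a double sum. Finiteness is asked of the support in each fibre of the
    composite, because an infinite support would silently give the default 0. *)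
Lemma pushf_comp (X Y Z : choiceType) (u : X -> Y) (v : Y -> Z) (f : X -> W) :
  (forall z, finite_set [set x | v (u x) = z /\ f x <> 0]) ->
  pushf v (pushf u f) = pushf (v \o u) f.
Proof.
move=> fin; apply/funext => z.
have [r ur rP] := finite_set_seq (fin z).
rewrite (@pushfE _ _ (v \o u) f z r)//; last by move=> x ? ?; apply: rP.
rewrite (@pushfE _ _ v _ z (undup (map u r))) ?undup_uniq//; last first.
  move=> y vy ne; rewrite mem_undup; apply: contrapT => nr; apply: ne.
  apply: pushf_eq0 => x uxy; apply: contrapT => fx; apply: nr.
  by apply/mapP; exists x => //; apply: rP; rewrite /= uxy.
under eq_bigr => y /eqP vy.
  rewrite (@pushfE _ _ u _ y r)//; last by move=> x uxy fx; apply: rP; rewrite /= uxy.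
over.
rewrite (exchange_big_dep (fun x => v (u x) == z))/=; last by move=> y x vy /eqP->.
rewrite [LHS]big_seq_cond [RHS]big_seq_cond.
apply: eq_bigr => x /andP[xr /eqP vux].
(* For fixed [x] only the term [y = u x] of the inner sum survives. *)
rewrite big_mkcond (bigD1_seq (u x)) ?undup_uniq ?mem_undup ?map_f//=.
rewrite vux !eqxx/= big1 ?addr0// => y /negPf nuy.
by rewrite [u x == y]eq_sym nuy andbF.
Qed.

Lemma pushf_ext (X Y : choiceType) (u v : X -> Y) (f : X -> W) :
  (forall x, u x = v x) -> pushf u f = pushf v f.
Proof. by move=> /funext->. Qed.

Lemma pushf_id (X : choiceType) (f : X -> W) : pushf id f = f.
Proof.
apply/funext => x; rewrite (@pushfE _ _ _ _ _ [:: x])//=; last first.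
  by move=> y ->; rewrite inE.
by rewrite big_cons big_nil eqxx addr0.
Qed.

Definition finite_to_one (X Y : Type) (u : X -> Y) :=
  forall y, finite_set (u @^-1` [set y]).

Lemma pushf_linear_finite (X Y : choiceType) (u : X -> Y) : finite_to_one u ->
  linear (@pushf R W X Y u).
Proof.
by move=> fu a f g; apply: pushf_linear => y; apply: sub_finite_set (fu y) => x [].
Qed.

Lemma sum_delta_seq (I : eqType) (s : seq I) (i : I) (F : I -> W) :
  uniq s -> i \in s ->
  \sum_(j <- s) (if i == j then F j else 0) = F i.
Proof.
move=> us si; rewrite (bigD1_seq i)//= eqxx big1 ?addr0// => j /negPf ji.
by rewrite eq_sym ji.
Qed.

End PushSums.

(** * Cells in terms of vertices, and prisms *)

Section Vertices.
Variable G : groupType.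

(** Entries past the tuple default to 1, so the vertex sequence is constant from index [n] on. *)
Definition vert n (p : cell G n) (i : nat) : G := vertex p.1 (nth 1%g p.2) i.

(** Recovers the entries as $g_{i+1}=x_ix_{i+1}^{-1}$. Vertices form a total sequence of which only
    the indices up to [n] matter, so faces and prisms become reindexings. *)
Definition cell_of n (x : nat -> G) : cell G n :=
  (x 0%N, [tuple (x i * (x i.+1)^-1)%g | i < n]).

Lemma eq_cell_of n (x y : nat -> G) :
  (forall i, (i <= n)%N -> x i = y i) -> cell_of n x = cell_of n y.
Proof.
move=> xy; congr pair; first exact: xy.
by apply: eq_from_tnth => i; rewrite !tnth_mktuple !xy// ltnW.
Qed.

Lemma vert_cell_of n (x : nat -> G) i : (i <= n)%N -> vert (cell_of n x) i = x i.
Proof.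
rewrite /vert; elim: i => //= i IHi ltin; rewrite IHi 1?ltnW//.
by rewrite -[i]/(nat_of_ord (Ordinal ltin)) nth_mktuple/= invgM invgK mulgVK.
Qed.

Lemma div_vert n (p : cell G n) i :
  (vert p i * (vert p i.+1)^-1)%g = nth 1%g p.2 i.
Proof. by rewrite /vert/= invgM invgK mulVKg. Qed.

Lemma cell_ofK n (p : cell G n) : cell_of n (vert p) = p.
Proof.
case: p => x g; congr pair.
by apply: eq_from_tnth => i; rewrite tnth_mktuple div_vert (tnth_nth 1%g).
Qed.

Lemma faceE n i (p : cell G n.+1) : face i p = cell_of n (vert p \o bump i).
Proof.
rewrite /face /cell_of; congr pair => /=.
  by case: i.
apply: eq_from_tnth => j; rewrite !tnth_mktuple /bump.
case: (ltngtP j.+1 i) => [ji|ij|<-].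
- have -> : (i <= j)%N = false by lia.
  by rewrite !add0n div_vert.
- have -> : (i <= j)%N by lia.
  by rewrite !add1n div_vert.
(* The two multiplied entries share the deleted vertex $x_i$, which cancels in the product. *)
- by rewrite ltnn add0n add1n -!div_vert mulgA mulgVK.
Qed.

End Vertices.

Lemma cell_mapE (G H : groupType) (phi : G -> H) n (p : cell G n) :
  cell_map phi p = cell_of n (phi \o vert p).
Proof. by []. Qed.

Lemma cell_map_comp (G H K : groupType) (phi : G -> H) (psi : H -> K) n
    (p : cell G n) : cell_map psi (cell_map phi p) = cell_map (psi \o phi) p.
Proof. by rewrite !cell_mapE; apply: eq_cell_of => i ltin /=; rewrite vert_cell_of. Qed.

Lemma face_cell_map (G H : groupType) (phi : G -> H) n i (p : cell G n.+1) :
  face i (cell_map phi p) = cell_map phi (face i p).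
Proof.
rewrite !faceE !cell_mapE; apply: eq_cell_of => j ltjn /=.
by rewrite !vert_cell_of// /bump; lia.
Qed.

Section Prism.
Variables (G : groupType) (theta : G -> G).

Definition prism n j (p : cell G n) : cell G n.+1 :=
  cell_of n.+1 (fun k => if (k <= j)%N then vert p k else theta (vert p k.-1)).

(** Interpolates between [theta] applied to every vertex at [j = 0] and the identity at
    [j = n.+1]. *)
Definition partial_map n j (p : cell G n) : cell G n :=
  cell_of n (fun k => if (k < j)%N then vert p k else theta (vert p k)).

Lemma partial_map_max n (p : cell G n) : partial_map n.+1 p = p.
Proof.
by rewrite -[RHS]cell_ofK; apply: eq_cell_of => k ltkn; rewrite ltnS ltkn.
Qed.

Ltac prism_cases := rewrite /bump;
  repeat (case: leqP => ? //=; rewrite ?add1n ?add0n//=);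
  try (exfalso; lia).

(** In the prism $x_j$ is followed by $\theta x_j$. Deleting the one here, and the other in the next
    lemma, leaves two consecutive interpolants; this is the source of the telescoping. *)
Lemma face_prism_diag n j (p : cell G n) : face j (prism j p) = partial_map j p.
Proof.
rewrite faceE; apply: eq_cell_of => k ltkn /=.
rewrite vert_cell_of; last by rewrite /bump; lia.
by prism_cases.
Qed.

Lemma face_prism_next n j (p : cell G n) :
  face j.+1 (prism j p) = partial_map j.+1 p.
Proof.
rewrite faceE; apply: eq_cell_of => k ltkn /=.
rewrite vert_cell_of; last by rewrite /bump; lia.
by prism_cases.
Qed.

Lemma face_prism_le n i j (p : cell G n.+1) : (i <= j)%N -> (j <= n)%N ->
  face i (prism j.+1 p) = prism j (face i p).
Proof.
move=> ij jn; rewrite !faceE /prism; apply: eq_cell_of => k ltkn /=.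
rewrite vert_cell_of; last by rewrite /bump; lia.
rewrite /bump; case: k ltkn => [|k] /= ltkn; prism_cases;
  rewrite ?vert_cell_of; try lia; rewrite /=; prism_cases.
Qed.

Lemma face_prism_ge n i j (p : cell G n.+1) : (j < i)%N -> (i <= n.+1)%N ->
  face i.+1 (prism j p) = prism j (face i p).
Proof.
move=> ij jn; rewrite !faceE /prism; apply: eq_cell_of => k ltkn /=.
rewrite vert_cell_of; last by rewrite /bump; lia.
rewrite /bump; case: k ltkn => [|k] /= ltkn; prism_cases;
  rewrite ?vert_cell_of; try lia; rewrite /=; prism_cases.
Qed.

End Prism.

(** * The alternating sum over the faces of prisms *)

Section PrismIdentity.
Variables (R : pzRingType) (V : lmodType R).

(** [D i j] stands for face [i] of prism [j], [E j i] for prism [j] of face [i], and [Q j] for the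
    interpolants. The two diagonals of [D] telescope; off them [D] cancels against [E], since the
    index shift changes the sign. *)
Lemma prism_sum n (D E : nat -> nat -> V) (Q : nat -> V) :
  (forall j, (j <= n)%N -> D j j = Q j) ->
  (forall j, (j <= n)%N -> D j.+1 j = Q j.+1) ->
  (forall i j, (i <= j)%N -> (j < n)%N -> D i j.+1 = E j i) ->
  (forall i j, (j < i)%N -> (i <= n)%N -> D i.+1 j = E j i) ->
  \sum_(i < n.+2) \sum_(j < n.+1) (-1) ^+ (i + j) *: D i j +
  \sum_(j < n) \sum_(i < n.+1) (-1) ^+ (i + j) *: E j i = Q 0%N - Q n.+1.
Proof.
move=> Dd Ds Dlt Dgt.
pose c i j : R := (-1) ^+ (i + j).
pose lo j := \sum_(0 <= i < j) c i j *: D i j.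
pose hi j := \sum_(j.+1 <= i < n.+1) c i.+1 j *: D i.+1 j.
have split_j j : (j <= n)%N ->
    \sum_(0 <= i < n.+2) c i j *: D i j = (Q j - Q j.+1) + lo j + hi j.
  move=> jn; rewrite (@big_cat_nat _ _ _ j)//=; last by rewrite leqW// leqW.
  rewrite [X in _ + X]big_ltn ?ltnS ?leqW//. rewrite [X in _ + (_ + X)]big_ltn ?ltnS// Dd// Ds//.
  rewrite /c addnn -signr_odd odd_double expr0 scale1r addSn addnn.
  rewrite -signr_odd/= odd_double/= expr1 scaleN1r big_add1/= !addrA.
  by rewrite -[in RHS](addrC (lo j)) !addrA.
have loS j : (j < n)%N -> lo j.+1 = - \sum_(0 <= i < j.+1) c i j *: E j i.
  move=> jn; rewrite /lo -sumrN; apply: eq_big_nat => i /andP[_ ij].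
  by rewrite Dlt// /c addnS exprS mulN1r scaleNr.
have hiE j : (j < n)%N -> hi j = - \sum_(j.+1 <= i < n.+1) c i j *: E j i.
  move=> jn; rewrite /hi -sumrN; apply: eq_big_nat => i /andP[ji iltn].
  by rewrite Dgt// /c addSn exprS mulN1r scaleNr.
rewrite exchange_big/= -(big_mkord xpredT (fun j => \sum_(i < n.+2) c i j *: D i j)).
rewrite -(big_mkord xpredT (fun j => \sum_(i < n.+1) c i j *: E j i)).
under eq_big_nat => j jn do rewrite -(big_mkord xpredT (fun i => c i j *: D i j)) split_j//.
under [X in _ + X]eq_big_nat => j jn
  do rewrite -(big_mkord xpredT (fun i => c i j *: E j i)).
rewrite big_split/= [X in X + _ + _]big_split/= -!addrA [X in X + _](_ : _ = Q 0%N - Q n.+1); last first.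
  rewrite -[RHS]opprB -telescope_sumr// -sumrN.
  by apply: eq_bigr => j _; rewrite opprB.
rewrite -[RHS]addr0; congr (_ + _).
(* [lo 0] and [hi n] are empty sums. Shifting [lo] by one index pairs [lo j.+1] with [hi j], and
   together they cancel row [j] of [E]. *)
rewrite big_nat_recl// [lo 0%N]big_geq// add0r [X in _ + (X + _)]big_nat_recr//=.
rewrite [hi n]big_geq// addr0 -!big_split/= big1_seq// => j.
rewrite mem_index_iota => /andP[_ jn]; rewrite loS// hiE//.
rewrite (@big_cat_nat _ _ _ j.+1 0 n.+1)//=; last by rewrite ltnS ltnW.
by rewrite addrA -opprD addNr.
Qed.

Variables (G : groupType) (theta : G -> G).

(** A 0-cell has no faces; the value for [n = 0] is a placeholder that is met only in an empty
    sum. *)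
Definition prism_face n : nat -> nat -> cell G n -> cell G n :=
  match n with
  | 0 => fun _ _ => id
  | m.+1 => fun j i p => prism theta j (face i p)
  end.

(** With [T] arbitrary, the identity can be used for [pushf u f] and for [pullf u f], so it yields
    both the homology and the cohomology homotopy. *)
Lemma prism_identity n (T : (cell G n -> cell G n) -> V) :
  \sum_(i < n.+2) \sum_(j < n.+1) (-1) ^+ (i + j) *: T (face i \o prism theta j) +
  \sum_(j < n) \sum_(i < n.+1) (-1) ^+ (i + j) *: T (prism_face j i) =
  T (@cell_map _ _ theta n) - T id.
Proof.
rewrite (@prism_sum n (fun i j => T (face i \o prism theta j))
  (fun j i => T (prism_face j i)) (fun j => T (partial_map theta j))).
- congr (_ - T _); apply/funext => p; exact: partial_map_max.
- by move=> j jn; congr T; apply/funext => p; exact: face_prism_diag.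
- by move=> j jn; congr T; apply/funext => p; exact: face_prism_next.
- case: n T => // n T i j ij jn.
  by congr T; apply/funext => p; exact: face_prism_le.
- case: n T => [|n] T i j ij jn; first by lia.
  by congr T; apply/funext => p; exact: face_prism_ge.
Qed.

End PrismIdentity.

(** * Controlled maps of cells *)

Lemma finite_tuples (T : Type) n (F : set T) : finite_set F ->
  finite_set [set t : n.-tuple T | forall i, F (tnth t i)].
Proof.
move=> finF; elim: n => [|n IHn].
  by apply: sub_finite_set (finite_set1 [tuple]) => t _; exact: tuple0.
apply: sub_finite_set (finite_image (fun p => cons_tuple p.1 p.2)
  (finite_setX finF IHn)) => t tF.
exists (thead t, behead_tuple t); last by rewrite [RHS]tuple_eta; apply: val_inj.
split=> /=; first exact: tF.
by move=> i; rewrite tnth_behead; exact: tF.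
Qed.

Section Controlled.
Variables (G H : groupType).

(** The first condition bounds the tuples reached from one slice, uniformly in the base point:
    push-forwards keep finite support and slices of pull-backs are finite sums. The second makes the
    fibre sums of a chain finite. *)
Definition controlled n m (u : cell G n -> cell H m) :=
  (forall g, finite_set (range (fun x => (u (x, g)).2))) /\
  (forall g y, finite_set [set x | u (x, g) = y]).

Lemma controlled_cell_of n m (w : cell G n -> nat -> H) :
  (forall g y, finite_set [set x | w (x, g) 0%N = y]) ->
  (forall g, exists2 F : set H, finite_set F &
    forall x i, (i < m)%N -> F (w (x, g) i * (w (x, g) i.+1)^-1)%g) ->
  controlled (fun p => cell_of m (w p)).
Proof.
move=> fin1 fin2; split=> g.
  have [F finF wF] := fin2 g.
  apply: sub_finite_set (finite_tuples m finF) => _ [x _ <-] i /=.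
  by rewrite tnth_mktuple; exact: wF.
by move=> y; apply: sub_finite_set (fin1 g y.1) => x /= <-.
Qed.

(** Consecutive vertices have quotients among the finitely many entries of [g], and a coarse map
    keeps the quotients of their images in a finite set. *)
Lemma coarse_controlled (phi : G -> H) n : coarse_map phi ->
  controlled (@cell_map _ _ phi n).
Proof.
move=> [fin1 fin2]; apply: (@controlled_cell_of _ _ (fun p => phi \o vert p)).
  by move=> g y; exact: fin1.
move=> g; pose S := [set s : G * G | (s.1 * s.2^-1)%g \in (g : seq G)].
exists [set (phi s.1 * (phi s.2)^-1)%g | s in S].
  apply: fin2; apply: sub_finite_set (finite_seq g).
  by move=> _ [s Ss <-].
move=> x i ltin; exists (vert (x, g) i, vert (x, g) i.+1) => //.
by rewrite /S/= div_vert mem_nth ?size_tuple.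
Qed.

End Controlled.

Lemma controlled_comp (G H K : groupType) n m k
    (u : cell G n -> cell H m) (v : cell H m -> cell K k) :
  controlled u -> controlled v -> controlled (v \o u).
Proof.
move=> [u1 u2] [v1 v2]; split=> g.
  apply: sub_finite_set (bigcup_finite (u1 g) (fun t _ => v1 t)).
  move=> _ [x _ <-]; exists (u (x, g)).2; first by exists x.
  by exists (u (x, g)).1 => //=; rewrite -surjective_pairing.
move=> y; apply: sub_finite_set (bigcup_finite (u1 g) (fun t _ =>
  bigcup_finite (v2 t y) (fun z _ => u2 g (z, t)))).
move=> x /= vux; exists (u (x, g)).2; first by exists x.
by exists (u (x, g)).1 => /=; rewrite -surjective_pairing.
Qed.

Lemma face_controlled (G : groupType) n i : controlled (@face G n i).
Proof.
split=> g.
  by apply: sub_finite_set (finite_set1 (face i (1%g, g)).2) => _ [x _ <-].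
move=> y; pose h := if i == 0%N then nth 1%g g 0 else 1%g.
apply: sub_finite_set (finite_set1 (h * y.1)%g) => x /= <-.
by rewrite /h/=; case: (i == 0%N); rewrite ?mulVKg ?mul1g.
Qed.

Definition close_to_id (G : groupType) (theta : G -> G) :=
  finite_set (range (fun x => theta x * x^-1)%g).

Lemma close_to_id_finite_to_one (G : groupType) (theta : G -> G) :
  close_to_id theta -> finite_to_one theta.
Proof.
move=> fin y; apply: sub_finite_set (finite_image (fun c => c^-1 * y)%g fin).
move=> x /= <-; exists (theta x * x^-1)%g; first by exists x.
by rewrite invgM invgK mulgVK.
Qed.

Lemma prism_controlled (G : groupType) (theta : G -> G) n j :
  close_to_id theta -> controlled (@prism G theta n j).
Proof.
move=> fin.
pose w (p : cell G n) k := if (k <= j)%N then vert p k else theta (vert p k.-1).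
apply: (@controlled_cell_of _ _ _ _ w).
  by move=> g y; apply: sub_finite_set (finite_set1 y) => x.
move=> g; pose C := [set 1%g] `|` range (fun x => theta x * x^-1)%g.
have finC : finite_set C by rewrite finite_setU.
pose E := [set 1%g] `|` [set x | x \in (g : seq G)].
have finE : finite_set E by rewrite finite_setU; split => //; exact: finite_seq.
(* Every edge of the prism is $c\,e\,d^{-1}$ with $c,d$ displacements of [theta] and $e$ an entry of
   the tuple. The neutral element in [C] serves unmoved ends; in [E] it serves the edge from $x_j$
   to $\theta x_j$ and the padding past [n]. *)
exists [set (p.1.1 * p.1.2 * p.2^-1)%g | p in C `*` E `*` C].
  by apply: finite_image; do 2?apply: finite_setX.
have C1 : C 1%g by left.
have Ct x : C (theta x * x^-1)%g by right; exists x.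
have Eg x i : E (vert (x, g) i * (vert (x, g) i.+1)^-1)%g.
  rewrite div_vert; have [ltin|lein] := ltnP i n.
    by right; rewrite /= mem_nth ?size_tuple.
  by left; rewrite nth_default ?size_tuple.
have mul1K (a : G) : (1 * a * 1^-1 = a)%g by rewrite invg1 mulg1 mul1g.
have divK (a b c d : G) : (a * b^-1 * (b * c^-1) * (d * c^-1)^-1 = a * d^-1)%g.
  by rewrite invgM invgK !mulgA !mulgVK.
move=> x i lei; rewrite /w; case: (ltngtP i j) => [ij|ji|->].
- exists (1, vert (x, g) i * (vert (x, g) i.+1)^-1, 1)%g.
    by split; [split; [exact: C1|exact: Eg]|exact: C1].
  exact: mul1K.
- case: i lei ji => // i lei _.
  exists (theta (vert (x, g) i) * (vert (x, g) i)^-1,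
    vert (x, g) i * (vert (x, g) i.+1)^-1,
    theta (vert (x, g) i.+1) * (vert (x, g) i.+1)^-1)%g.
    by split; [split; [exact: Ct|exact: Eg]|exact: Ct].
  exact: divK.
- exists (1, 1, theta (vert (x, g) j) * (vert (x, g) j)^-1)%g.
    by split; [split; [exact: C1|left]|exact: Ct].
  by rewrite -[RHS](divK _ (vert (x, g) j) (vert (x, g) j)) !mulgV.
Qed.

Lemma finite_vertices (G : groupType) n (F : set G) : finite_set F ->
  finite_set [set p : cell G n | forall k, (k <= n)%N -> F (vert p k)].
Proof.
move=> finF; pose E := [set (s.1 * s.2^-1)%g | s in F `*` F].
have finE : finite_set E by apply: finite_image; exact: finite_setX.
apply: sub_finite_set (finite_setX finF (finite_tuples n finE)) => p Fp.
split; first exact: (Fp 0%N).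
move=> i; exists (vert p i, vert p i.+1); first by split; apply: Fp => //; rewrite ltnW.
by rewrite /= div_vert (tnth_nth 1%g).
Qed.

(** The vertices of a preimage lie in finitely many finite fibres, and they determine the cell. This
    gives linearity of the fibre sums on all functions, not just on chains. *)
Lemma cell_map_finite_to_one (G H : groupType) (phi : G -> H) n :
  finite_to_one phi -> finite_to_one (@cell_map _ _ phi n).
Proof.
move=> fin q; pose F := \bigcup_(k in [set k | (k < n.+1)%N]) phi @^-1` [set vert q k].
have finF : finite_set F by apply: bigcup_finite => *; [exact: finite_II|exact: fin].
apply: sub_finite_set (finite_vertices n finF) => p pq k kn.
have {}pq : cell_map phi p = q by [].
by exists k => //=; rewrite -pq cell_mapE vert_cell_of.
Qed.

Lemma prism_finite_to_one (G : groupType) (theta : G -> G) n j :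
  finite_to_one theta -> finite_to_one (@prism G theta n j).
Proof.
move=> fin q; pose F := \bigcup_(k in [set k | (k < n.+2)%N])
  ([set vert q k] `|` theta @^-1` [set vert q k]).
have finF : finite_set F.
  apply: bigcup_finite => [|k _]; first exact: finite_II.
  by rewrite finite_setU; split; [exact: finite_set1|exact: fin].
apply: sub_finite_set (finite_vertices n finF) => p pq k kn.
have {}pq : prism theta j p = q by [].
have [kj|jk] := leqP k j.
  exists k; first by rewrite /= ltnS leqW.
  by left; rewrite -pq /prism /= vert_cell_of ?leqW// kj.
exists k.+1 => //; right.
by rewrite /= -pq /prism /= vert_cell_of// leqNgt ltnW.
Qed.

(** * Slices of push-forwards and pull-backs *)

Section Slices.
Variables (R : pzRingType) (W : lmodType R) (G H : groupType) (phi : G -> H).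
Hypothesis phi_fin : finite_to_one phi.

(** As [u] acts on base points by [phi], the fibre sum can be organised by the source tuple [g]; the
    condition on the target tuple then becomes a restriction of the slice at [g], which
    res-invariance permits. *)
Lemma slice_pushf n m (u : cell G n -> cell H m) (f : cell G n -> W) h s :
  (forall p, (u p).1 = phi p.1) -> uniq s ->
  (forall x g, (u (x, g)).2 = h -> f (x, g) <> 0 -> g \in s) ->
  slice (pushf u f) h =
  \sum_(g <- s) pushf phi (cut [set x | (u (x, g)).2 = h] (slice f g)).
Proof.
move=> u1 us sP; rewrite fct_sumE; apply/funext => y; rewrite {1}/slice.
have [t ut tP] := finite_set_seq (phi_fin y).
rewrite (@pushfE _ _ _ _ _ _ _ [seq (x, g) | x <- t, g <- s]); first last.
- move=> [x g] uxg fxg; apply: allpairs_f; last by apply: sP fxg; rewrite uxg.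
  by apply: tP; rewrite /= -(u1 (x, g)) uxg.
- by apply: allpairs_uniq => // -[x g] [x' g'].
rewrite big_mkcond big_allpairs exchange_big/=; apply: eq_bigr => g _.
rewrite (@pushfE _ _ _ _ _ _ _ t)//; last by move=> x xy _; exact: tP.
rewrite [RHS]big_mkcond; apply: eq_bigr => x _.
rewrite cutE -[phi x](u1 (x, g)) [u (x, g) in LHS]surjective_pairing xpair_eqE.
have -> : (x \in [set x0 | (u (x0, g)).2 = h]) = ((u (x, g)).2 == h).
  by apply/idP/eqP; rewrite inE.
by case: eqP.
Qed.

Lemma slice_pullf n m (u : cell G n -> cell H m) (f : cell H m -> W) g s :
  (forall p, (u p).1 = phi p.1) -> uniq s -> (forall x, (u (x, g)).2 \in s) ->
  slice (pullf u f) g =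
  \sum_(h <- s) cut [set x | (u (x, g)).2 = h] (pullf phi (slice f h)).
Proof.
move=> u1 us sP; rewrite fct_sumE; apply/funext => x.
transitivity (f (phi x, (u (x, g)).2)).
  by rewrite /slice /pullf/= -(u1 (x, g)) -surjective_pairing.
rewrite -(sum_delta_seq (fun h => f (phi x, h)) us (sP x)).
apply: eq_bigr => h _; rewrite cutE.
have -> : (x \in [set x0 | (u (x0, g)).2 = h]) = ((u (x, g)).2 == h).
  by apply/idP/eqP; rewrite inE.
by [].
Qed.

End Slices.

(** * Restriction, translation and maps close to the identity *)

Section LinearOps.
Variables (R : pzRingType) (W : lmodType R).

Fact cut_linear (T : Type) (A : set T) : linear (@cut R W T A).
Proof.
move=> a f g; apply/funext => x; rewrite cutE.
rewrite [RHS](_ : _ = a *: cut A f x + cut A g x)// !cutE.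
by case: ifP => // _; rewrite scaler0 addr0.
Qed.
HB.instance Definition _ (T : Type) (A : set T) :=
  GRing.isLinear.Build R (T -> W) (T -> W) _ (@cut R W T A) (@cut_linear T A).

Fact translate_linear (G : groupType) (g : G) : linear (@translate R W G g).
Proof. by []. Qed.
HB.instance Definition _ (G : groupType) (g : G) :=
  GRing.isLinear.Build R (G -> W) (G -> W) _ (@translate R W G g)
    (@translate_linear G g).

Fact pullf_linear (X Y : Type) (u : X -> Y) : linear (@pullf R W X Y u).
Proof. by []. Qed.
HB.instance Definition _ (X Y : Type) (u : X -> Y) :=
  GRing.isLinear.Build R (Y -> W) (X -> W) _ (@pullf R W X Y u)
    (@pullf_linear X Y u).

Lemma pushf_sum (X Y : choiceType) (u : X -> Y) I (r : seq I) (F : I -> X -> W) :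
  finite_to_one u ->
  pushf u (\sum_(i <- r) F i) = \sum_(i <- r) pushf u (F i).
Proof.
move=> fu; have lin := @pushf_linear_finite R W _ _ _ fu.
have p0 : pushf u (0 : X -> W) = 0.
  by apply/funext => y; exact: pushf_eq0.
elim: r => [|i r IH]; first by rewrite !big_nil.
by rewrite !big_cons -IH -[F i]scale1r lin !scale1r.
Qed.

Lemma cut_cut (T : Type) (A B : set T) (f : T -> W) :
  cut A (cut B f) = cut (A `&` B) f.
Proof.
by apply/funext => x; rewrite !cutE in_setI; case: (x \in A).
Qed.

Lemma translateM (G : groupType) (g h : G) (f : G -> W) :
  translate g (translate h f) = translate (g * h)%g f.
Proof. by apply/funext => x; rewrite /translate invgM mulgA. Qed.

Lemma translate1 (G : groupType) (f : G -> W) : translate 1%g f = f.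
Proof. by apply/funext => x; rewrite /translate invg1 mul1g. Qed.

Lemma translate_cut (G : groupType) (g : G) (A : set G) (f : G -> W) :
  translate g (cut A f) = cut [set x | A (g^-1 * x)%g] (translate g f).
Proof.
apply/funext => x; rewrite /translate !cutE.
by have -> : (x \in [set x | A (g^-1 * x)%g]) = ((g^-1 * x)%g \in A)
  by apply/idP/idP; rewrite !inE.
Qed.

Lemma cut_pushf (X Y : choiceType) (u : X -> Y) (A : set Y) (f : X -> W) :
  cut A (pushf u f) = pushf u (cut (u @^-1` A) f).
Proof.
apply/funext => y; rewrite cutE; case: ifPn => yA.
  apply: eq_fsbigr => x /set_mem/= xy.
  by rewrite cutE ifT//; apply/mem_set; rewrite /= xy; apply/set_mem.
apply/esym/pushf_eq0 => x xy; rewrite cutE ifF//; apply/negP => /set_mem/= Aux.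
by move/negP: yA; apply; apply/mem_set; rewrite -xy.
Qed.

Lemma translate_pushf (X : choiceType) (G : groupType) (g : G) (u : X -> G)
    (f : X -> W) : translate g (pushf u f) = pushf (fun x => g * u x)%g f.
Proof.
apply/funext => y; rewrite /translate /pushf; congr (\sum_(x \in _) f x).
apply/seteqP; split => x /=; first by move->; rewrite mulVKg.
by move<-; rewrite mulKg.
Qed.

Variable (G : groupType) (theta : G -> G).

(** Split [G] by the displacement $c=\theta(x)x^{-1}$: on each of the finitely many parts [theta] is
    left translation by $c$. *)
Lemma pushf_close (f : G -> W) (s : seq G) :
  uniq s -> (forall x, (theta x * x^-1)%g \in s) ->
  pushf theta f = \sum_(c <- s) translate c (cut [set x | theta x = c * x]%g f).
Proof.
move=> us sP; rewrite fct_sumE; apply/funext => y.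
rewrite (@pushfE _ _ _ _ _ _ _ [seq (c^-1 * y)%g | c <- s]); first last.
- by move=> x <- _; apply/mapP; exists (theta x * x^-1)%g; rewrite ?sP// invgM invgK mulgVK.
- by rewrite map_inj_uniq// => c d /mulIg/invg_inj.
rewrite big_map big_mkcond; apply: eq_bigr => c _; rewrite /translate cutE.
have -> // : ((c^-1 * y)%g \in [set x | theta x = c * x]%g) = (theta (c^-1 * y)%g == y).
by apply/idP/eqP; rewrite inE/= mulVKg.
Qed.

Lemma pullf_close (f : G -> W) (s : seq G) :
  uniq s -> (forall x, (theta x * x^-1)%g \in s) ->
  pullf theta f = \sum_(c <- s) cut [set x | theta x = c * x]%g (translate c^-1 f)%g.
Proof.
move=> us sP; rewrite fct_sumE; apply/funext => x.
transitivity (f (theta x * x^-1 * x)%g); first by rewrite mulgVK.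
rewrite -(sum_delta_seq (fun c => f (c * x)%g) us (sP x)).
apply: eq_bigr => c _; rewrite cutE /translate invgK.
have -> // : (x \in [set x | theta x = c * x]%g) = (theta x * x^-1 == c)%g.
by apply/idP/eqP => [/set_mem/= ->|<-]; [rewrite mulgK|apply/mem_set; rewrite /= mulgVK].
Qed.

End LinearOps.

(** * Chain maps and homotopies *)

Section Chains.
Variables (R : pzRingType) (W : lmodType R).

Lemma chains_fin (G H : groupType) (L : resModule W G) n m
    (u : cell G n -> cell H m) (f : cell G n -> W) y :
  f \in chains L n -> controlled u -> finite_set [set p | u p = y /\ f p <> 0].
Proof.
move=> /set_mem[_ fin] [_ fu].
apply: sub_finite_set (bigcup_finite fin (fun g _ =>
  finite_image (fun x => (x, g)) (fu g y))) => -[x g] [/= uxg fxg].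
exists g; first by move=> /(congr1 (@^~ x)).
by exists x.
Qed.

Lemma pushf_comp_chains (G H K : groupType) (L : resModule W G) n m k
    (u : cell G n -> cell H m) (v : cell H m -> cell K k) (f : cell G n -> W) :
  f \in chains L n -> controlled u -> controlled v ->
  pushf v (pushf u f) = pushf (v \o u) f.
Proof.
move=> fL cu cv; apply: pushf_comp => z.
exact: chains_fin fL (controlled_comp cu cv).
Qed.

Lemma pushfZ (X Y : choiceType) (u : X -> Y) (a : R) (f : X -> W) :
  finite_to_one u -> pushf u (a *: f) = a *: pushf u f.
Proof.
move=> fu; have := pushf_linear_finite fu a f 0; rewrite !addr0 => ->.
by rewrite [pushf u 0](_ : _ = 0) ?addr0//; apply/funext => y; exact: pushf_eq0.
Qed.

Lemma pullfZ (X Y : Type) (u : X -> Y) (a : R) (f : Y -> W) :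
  pullf u (a *: f) = a *: pullf u f.
Proof. by []. Qed.

Lemma pullf_sum (X Y : Type) (u : X -> Y) I (r : seq I) (F : I -> Y -> W) :
  pullf u (\sum_(i <- r) F i) = \sum_(i <- r) pullf u (F i).
Proof. exact: raddf_sum. Qed.

Section Coefficients.
Variables (G H : groupType) (phi : G -> H).
Hypothesis phi_coarse : coarse_map phi.
Let phi_fin : finite_to_one phi := phi_coarse.1.

Section Push.
Variables (L : resModule W G) (L' : resModule W H).
Hypothesis LL' : forall f, f \in L -> pushf phi f \in L'.

(** Stated for any controlled [u] over [phi] so as to cover the cell maps of [phi] and, over the
    identity, the prisms. *)
Lemma pushf_chains n m (u : cell G n -> cell H m) (f : cell G n -> W) :
  controlled u -> (forall p, (u p).1 = phi p.1) ->
  f \in chains L n -> pushf u f \in chains L' m.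
Proof.
move=> [cu _] u1 /set_mem[/set_mem fL fin]; apply/mem_set; split.
  apply/mem_set => h; have [s us sP] := finite_set_seq fin.
  rewrite (slice_pushf phi_fin u1 us); last first.
    by move=> x g _ fxg; apply: sP => /(congr1 (@^~ x)).
  by apply: rpred_sum => g _; apply/LL'/cut_in.
apply: sub_finite_set (bigcup_finite fin (fun g _ => cu g)) => h /= ne.
apply: contrapT => nh; apply: ne; apply/funext => y; apply: pushf_eq0 => -[x g] uxg.
apply: contrapT => fxg; apply: nh; exists g; first by move=> /(congr1 (@^~ x)).
by exists x; rewrite // uxg.
Qed.

Lemma chain_map_chains n (f : cell G n -> W) :
  f \in chains L n -> chain_map phi f \in chains L' n.
Proof. by apply: pushf_chains => //; exact: coarse_controlled. Qed.

Lemma bd_chain_map n (f : cell G n -> W) :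
  f \in chains L n -> bd (chain_map phi f) = chain_map phi (bd f).
Proof.
case: n f => [|n] f fL.
  by apply/esym/funext => y; exact: pushf_eq0.
have cc k := @coarse_controlled _ _ phi k phi_coarse.
rewrite /= /chain_map pushf_sum; last exact: cell_map_finite_to_one.
apply: eq_bigr => i _; rewrite pushfZ; last exact: cell_map_finite_to_one.
rewrite !(pushf_comp_chains fL) //; [|exact: face_controlled..].
by congr (_ *: pushf _ f); apply/funext => p; exact: face_cell_map.
Qed.

Lemma chain_map_cycles n (f : cell G n -> W) :
  f \in cycles L n -> chain_map phi f \in cycles L' n.
Proof.
move=> /set_mem[fL f0]; apply/mem_set; split; first exact: chain_map_chains.
by rewrite bd_chain_map// f0; apply/funext => y; exact: pushf_eq0.
Qed.

Lemma chain_map_boundaries n (f : cell G n -> W) :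
  f \in boundaries L n -> chain_map phi f \in boundaries L' n.
Proof.
move=> /set_mem[e eL <-]; apply/mem_set; exists (chain_map phi e).
  exact: chain_map_chains.
exact: bd_chain_map.
Qed.

End Push.

Section Pull.
Variables (M : resModule W H) (M' : resModule W G).
Hypothesis MM' : forall f, f \in M -> pullf phi f \in M'.

Lemma pullf_cochains n m (u : cell G n -> cell H m) (f : cell H m -> W) :
  controlled u -> (forall p, (u p).1 = phi p.1) ->
  f \in cochains M m -> pullf u f \in cochains M' n.
Proof.
move=> [cu _] u1 /set_mem fM; apply/mem_set => g.
have [s us sP] := finite_set_seq (cu g).
rewrite (slice_pullf f u1 us); last by move=> x; apply: sP; exists x.
by apply: rpred_sum => h _; apply/cut_in/MM'.
Qed.

Lemma cochain_map_cochains n (f : cell H n -> W) :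
  f \in cochains M n -> cochain_map phi f \in cochains M' n.
Proof. by apply: pullf_cochains => //; exact: coarse_controlled. Qed.

Lemma cobd_cochain_map n (f : cell H n -> W) :
  cobd (cochain_map phi f) = cochain_map phi (cobd f).
Proof.
rewrite /cobd /cochain_map pullf_sum; apply: eq_bigr => i _.
rewrite pullfZ; congr (_ *: _); apply/funext => p.
by rewrite /pullf/= face_cell_map.
Qed.

Lemma cochain_map_cocycles n (f : cell H n -> W) :
  f \in cocycles M n -> cochain_map phi f \in cocycles M' n.
Proof.
move=> /set_mem[fM f0]; apply/mem_set; split; first exact: cochain_map_cochains.
by rewrite cobd_cochain_map f0; exact: raddf0.
Qed.

Lemma cochain_map_coboundaries n (f : cell H n -> W) :
  f \in coboundaries M n -> cochain_map phi f \in coboundaries M' n.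
Proof.
case: n f => [|n] f /set_mem; first by move=> ->; apply/mem_set; exact: raddf0.
move=> [e eM <-]; apply/mem_set; exists (cochain_map phi e).
  exact: cochain_map_cochains.
exact: cobd_cochain_map.
Qed.

End Pull.
End Coefficients.

Section Homotopy.
Variables (G : groupType) (theta : G -> G).
Hypothesis theta_close : close_to_id theta.

Lemma id_coarse : coarse_map (@id G).
Proof.
split=> [y|S finS]; first by apply: sub_finite_set (finite_set1 y) => x.
exact: finS.
Qed.

(** A prism keeps the first vertex, so it lies over the identity and its slices stay in [L]. *)
Lemma prism_chains (L : resModule W G) n j (f : cell G n -> W) :
  f \in chains L n -> pushf (prism theta j) f \in chains L n.+1.
Proof.
apply: (pushf_chains id_coarse) => [e|//|//]; first by rewrite pushf_id.
exact: prism_controlled.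
Qed.

Lemma chain_homotopy (L : resModule W G) n (f : cell G n -> W) :
  f \in cycles L n -> chain_map theta f - f \in boundaries L n.
Proof.
move=> /set_mem[fL f0]; apply/mem_set.
exists (\sum_(j < n.+1) (-1) ^+ j *: pushf (prism theta j) f).
  by apply: rpred_sum => j _; apply: rpredZ; exact: prism_chains.
(* Additivity of [bd] is available on chains, so the induction carries along that the partial sums
   are chains. *)
have bd_sum (s : seq 'I_n.+1) :
    bd (\sum_(j <- s) (-1) ^+ j *: pushf (prism theta j) f) =
    \sum_(j <- s) (-1) ^+ j *: bd (pushf (prism theta j) f) /\
    \sum_(j <- s) (-1) ^+ j *: pushf (prism theta j) f \in chains L n.+1.
  elim: s => [|j s [IH1 IH2]]; first by rewrite !big_nil; split; [exact: (bd0 L)|exact: rpred0].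
  rewrite !big_cons (bd_linear _ (prism_chains _ fL) IH2) IH1; split=> //.
  by apply: rpredD => //; apply: rpredZ; exact: prism_chains.
rewrite (bd_sum _).1.
have /= := @prism_identity R _ _ theta n (fun u => pushf u f).
rewrite pushf_id /chain_map => <-; rewrite [X in _ = _ + X](_ : _ = 0) ?addr0; last first.
  case: n f fL f0 {bd_sum} => [|n] f fL f0; first by rewrite big_ord0.
  (* For each [j] these terms assemble to the prism of [bd f], which is 0 because [f] is a cycle. *)
  rewrite big1// => j _; under eq_bigr => i _.
    rewrite -(pushf_comp_chains fL (face_controlled _ _ i) (prism_controlled _ _ theta_close)).
    rewrite addnC exprD -scalerA.
    rewrite -pushfZ; last exact: (prism_finite_to_one _ (close_to_id_finite_to_one theta_close)).
  over.
  rewrite -scaler_sumr -pushf_sum; last exact: (prism_finite_to_one _ (close_to_id_finite_to_one theta_close)).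
  rewrite [X in pushf _ X](_ : _ = 0)//.
  by rewrite [pushf _ _](_ : _ = 0) ?scaler0//; apply/funext => y; exact: pushf_eq0.
rewrite exchange_big/=; apply: eq_bigr => j _.
rewrite scaler_sumr; apply: eq_bigr => i _.
rewrite scalerA -exprD addnC (pushf_comp_chains fL)//; last exact: face_controlled.
exact: prism_controlled.
Qed.

Lemma cochain_homotopy (M : resModule W G) n (f : cell G n -> W) :
  f \in cocycles M n -> cochain_map theta f - f \in coboundaries M n.
Proof.
move=> /set_mem[fM f0].
have := @prism_identity R _ _ theta n (fun u => pullf u f).
(* Pulling back reverses composition: the faces of prisms now give pull-backs of [cobd f = 0], and
   the prisms of faces give the coboundary. *)
rewrite [X in X + _ = _](_ : _ = 0) ?add0r; last first.
  rewrite exchange_big big1//= => j _.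
  transitivity ((-1) ^+ j *: pullf (prism theta j) (cobd f)); last first.
    by rewrite f0 [pullf _ _](_ : _ = 0) ?scaler0.
  rewrite /cobd pullf_sum scaler_sumr; apply: eq_bigr => i _.
  by rewrite pullfZ scalerA -exprD addnC.
rewrite -[pullf id f]/f -[pullf _ f]/(cochain_map theta f) => <-.
(* In degree 0 the remaining sum is empty, in accordance with the coboundaries being 0 there. *)
case: n f fM f0 => [|n] f fM f0; first by rewrite big_ord0 rpred0.
apply/mem_set; exists (\sum_(j < n.+1) (-1) ^+ j *: pullf (prism theta j) f).
  apply: rpred_sum => j _; apply: rpredZ.
  have MM (e : G -> W) : e \in M -> pullf id e \in M by [].
  by apply: (pullf_cochains MM) => //; exact: prism_controlled.
rewrite /cobd exchange_big/=; apply: eq_bigr => i _.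
rewrite pullf_sum scaler_sumr; apply: eq_bigr => j _.
by rewrite pullfZ scalerA -exprD.
Qed.

End Homotopy.
End Chains.

(** * Maps of quotient modules *)

Section QuotientMap.
Variables (R : pzRingType) (V V' : lmodType R).
Variables (B : submodClosed V) (B' : submodClosed V') (F : V -> V').
Hypothesis (F_lin : linear F) (FB : forall x, x \in B -> F x \in B').
Local Open Scope quotient_scope.

Definition quot_map (q : quotmod B) : quotmod B' := \pi_(quotmod B') (F (repr q)).

Lemma quot_map_pi x : quot_map (\pi_(quotmod B) x) = \pi_(quotmod B') (F x).
Proof.
have FD y z : F (y - z) = F y - F z.
  by rewrite addrC -scaleN1r F_lin scaleN1r addrC.
by apply/quotmod_eqP; rewrite -FD; apply: FB; apply/quotmod_eqP; rewrite reprK.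
Qed.

Lemma quot_map_linear : linear quot_map.
Proof.
move=> a x y; rewrite -[x]reprK -[y]reprK.
rewrite -[a *: _](quotmod_piZ B a (repr x)) -quotmod_piD !quot_map_pi F_lin.
by rewrite quotmod_piD quotmod_piZ.
Qed.

End QuotientMap.

Section QuotientIso.
Variables (R : pzRingType) (V V' : lmodType R).
Variables (B : submodClosed V) (B' : submodClosed V') (F : V -> V') (F' : V' -> V).
Hypothesis (F_lin : linear F) (FB : forall x, x \in B -> F x \in B').
Hypothesis (F'_lin : linear F') (FB' : forall x, x \in B' -> F' x \in B).
Hypothesis FK : forall x, F' (F x) - x \in B.

Lemma quot_mapK : cancel (@quot_map _ _ _ B B' F) (@quot_map _ _ _ B' B F').
Proof.
move=> q; rewrite -[q]reprK [quot_map _ F _]quot_map_pi// quot_map_pi//.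
by apply/quotmod_eqP.
Qed.

End QuotientIso.

Section Restrict.
Variables (R : pzRingType) (V V' : lmodType R) (Z : submodClosed V) (Z' : submodClosed V').
Variable F : V -> V'.
Hypothesis FZ : forall f, f \in Z -> F f \in Z'.

Definition restrict_map (z : elts Z) : elts Z' := exist _ (F (\val z)) (FZ (valP z)).

Lemma restrict_map_linear : linear F -> linear restrict_map.
Proof. by move=> F_lin a x y; apply: val_inj; rewrite /= F_lin. Qed.

End Restrict.

Lemma induced_quot_map (R : pzRingType) (V V' : lmodType R)
    (Z : submodClosed V) (Z' : submodClosed V')
    (B : submodClosed (elts Z)) (B' : submodClosed (elts Z')) (F : V -> V')
    (FZ : forall f, f \in Z -> F f \in Z') : linear F ->
  (forall z, z \in B -> restrict_map FZ z \in B') ->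
  @induced_by _ _ _ _ _ B B' F (quot_map B' (restrict_map FZ)).
Proof.
move=> F_lin FB z; exists (restrict_map FZ z) => //.
by apply: quot_map_pi => //; exact: restrict_map_linear.
Qed.

(** * Return of the coefficients under a coarse inverse *)

Section Coefficients.
Variables (R : pzRingType) (W : lmodType R).

Lemma pushf_close_in (G : groupType) (L : resModule W G) (theta : G -> G) f :
  close_to_id theta -> f \in L -> pushf theta f \in L.
Proof.
move=> fin fL; have [s us sP] := finite_set_seq fin.
rewrite (pushf_close f us); last by move=> x; apply: sP; exists x.
by apply: rpred_sum => c _; apply/translate_in/cut_in.
Qed.

Lemma pullf_close_in (G : groupType) (L : resModule W G) (theta : G -> G) f :
  close_to_id theta -> f \in L -> pullf theta f \in L.
Proof.
move=> fin fL; have [s us sP] := finite_set_seq fin.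
rewrite (pullf_close f us); last by move=> x; apply: sP; exists x.
by apply: rpred_sum => c _; apply/cut_in/translate_in.
Qed.

(** $h\varphi(x)$ and $\varphi(x)$ differ by the fixed $h$, so their images under the coarse map
    [psi] have quotients in a finite set. Such maps arise when [psi] is applied to a translate of a
    push-forward. *)
Lemma close_shift (G H : groupType) (phi : G -> H) (psi : H -> G) (h : H) :
  coarse_map psi -> close_to_id (psi \o phi) ->
  close_to_id (fun x => psi (h * phi x)%g).
Proof.
move=> [_ cpsi] close; pose S := [set s : H * H | (s.1 * s.2^-1)%g = h].
have finS : finite_set [set (s.1 * s.2^-1)%g | s in S].
  by apply: sub_finite_set (finite_set1 h) => _ [s Ss <-].
apply: sub_finite_set (finite_image (fun p => p.1 * p.2)%g
  (finite_setX (cpsi _ finS) close)) => _ [x _ <-].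
exists (psi (h * phi x) * (psi (phi x))^-1, psi (phi x) * x^-1)%g.
  by split; [exists (h * phi x, phi x)%g => //; rewrite /S/= mulgK|exists x].
by rewrite /= mulgA mulgVK.
Qed.

Lemma cut_translate_pushf (G H K : groupType) (phi : G -> H) (psi : H -> K)
    (A : set H) (h : H) (f : G -> W) : finite_to_one phi -> finite_to_one psi ->
  pushf psi (cut A (translate h (pushf phi f))) =
  pushf (fun x => psi (h * phi x)%g) (cut [set x | A (h * phi x)%g] f).
Proof.
move=> fphi fpsi; rewrite translate_pushf cut_pushf pushf_comp// => z.
apply: sub_finite_set (bigcup_finite (fpsi z) (fun y _ => fphi (h^-1 * y)%g)).
by move=> x [/= <- _]; exists (h * phi x)%g; rewrite //= mulKg.
Qed.

Lemma cut_translate_pullf (G H K : groupType) (phi : G -> H) (psi : K -> G)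
    (A : set G) (g : G) (f : H -> W) :
  pullf psi (cut A (translate g (pullf phi f))) =
  cut (psi @^-1` A) (pullf (fun y => phi (g^-1 * psi y)%g) f).
Proof. by []. Qed.

Lemma res_span_ind (G : groupType) (F P : set (G -> W)) :
  P 0 -> (forall (a : R) f1 f2, P f1 -> P f2 -> P (a *: f1 + f2)) ->
  (forall g f, P f -> P (translate g f)) -> (forall A f, P f -> P (cut A f)) ->
  (forall f, F f -> P f) -> forall f, f \in res_span F -> P f.
Proof.
move=> P0 Plin Pt Pc FP f.
have Pclosed : subsemimod_closed (mem P).
  split; first split; first exact/mem_set.
    move=> x y /set_mem Px /set_mem Py; apply/mem_set.
    by have := Plin 1 _ _ Px Py; rewrite scale1r.
  move=> a x /set_mem Px; apply/mem_set.
  by have := Plin a _ _ Px P0; rewrite addr0.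
pose S0 : submodClosed (G -> W) :=
  HB.pack (mem P : {pred G -> W}) (GRing.isSubmodClosed.Build R _ _ Pclosed).
have S0t g e : e \in S0 -> translate g e \in S0.
  by move=> /set_mem Pe; apply/mem_set/Pt.
have S0c A e : e \in S0 -> cut A e \in S0.
  by move=> /set_mem Pe; apply/mem_set/Pc.
move=> /set_mem /(_ (ResModule S0t S0c)) fS; apply/set_mem/fS => e Fe.
exact/mem_set/FP.
Qed.

Lemma cutT (T : Type) (f : T -> W) : cut setT f = f.
Proof. by apply/funext => x; rewrite cutE in_setT. Qed.

Variables (G H : groupType) (phi : G -> H) (psi : H -> G).
Hypotheses (phi_coarse : coarse_map phi) (psi_coarse : coarse_map psi).

Lemma pushf_push_in (L : resModule W G) f : close_to_id (psi \o phi) ->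
  f \in push phi L -> pushf psi f \in L.
Proof.
move=> close; have fpsi : finite_to_one psi := psi_coarse.1.
(* The claim is strengthened to all restricted translates, a class stable under further translation
   and restriction, so that induction over the span applies. On generators it reduces to the maps of
   [close_shift]. *)
suff main : f \in push phi L -> forall A h, pushf psi (cut A (translate h f)) \in L.
  by move=> /main /(_ setT 1%g); rewrite translate1 cutT.
move: f; apply: res_span_ind.
- move=> A h; rewrite !raddf0 [pushf _ _](_ : _ = 0) ?rpred0//.
  by apply/funext => y; exact: pushf_eq0.
- move=> a f1 f2 h1 h2 A h; rewrite !linearP pushf_linear_finite//.
  by apply: rpredD; [apply: rpredZ; exact: h1|exact: h2].
- by move=> g f fP A h; rewrite translateM; exact: fP.
- by move=> B f fP A h; rewrite translate_cut cut_cut; exact: fP.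
- move=> _ [e eL <-] A h; rewrite cut_translate_pushf//; last exact: phi_coarse.1.
  by apply: pushf_close_in; [exact: close_shift|exact: cut_in].
Qed.

Lemma pullf_pull_in (M : resModule W H) f : close_to_id (phi \o psi) ->
  f \in pull phi M -> pullf psi f \in M.
Proof.
move=> close.
suff main : f \in pull phi M -> forall A g, pullf psi (cut A (translate g f)) \in M.
  by move=> /main /(_ setT 1%g); rewrite translate1 cutT.
move: f; apply: res_span_ind.
- by move=> A h; rewrite !raddf0 rpred0.
- move=> a f1 f2 h1 h2 A h; rewrite !linearP.
  by apply: rpredD; [apply: rpredZ; exact: h1|exact: h2].
- by move=> g f fP A h; rewrite translateM; exact: fP.
- by move=> B f fP A h; rewrite translate_cut cut_cut; exact: fP.
- move=> _ [e eM <-] A g; rewrite cut_translate_pullf.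
  by apply: cut_in; apply: pullf_close_in => //; exact: close_shift.
Qed.

End Coefficients.

(** * Continuity *)

Lemma continuous_comp_all (S T U : topologicalType) (f : S -> T) (g : T -> U) :
  continuous f -> continuous g -> continuous (g \o f).
Proof. by move=> cf cg x; apply: continuous_comp; [exact: cf|exact: cg]. Qed.

Lemma final_continuous (I : Type) (S : I -> topologicalType) (T : choiceType)
    (s : forall i, S i -> T) (U : topologicalType) (f : final_topology s -> U) :
  (forall i, continuous (fun x : S i => f (s i x))) -> continuous f.
Proof.
move=> cf; apply/continuousP => A oA.
have oi i : open (s i @^-1` (f @^-1` A)) by have /continuousP/(_ _ oA) := cf i.
exact: oi.
Qed.

Lemma final_inj_continuous (I : Type) (S : I -> topologicalType) (T : choiceType)
    (s : forall i, S i -> T) i : continuous (s i : S i -> final_topology s).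
Proof. by apply/continuousP => A oA; have : final_open s A by []; exact. Qed.

Lemma prod_continuous (I : Type) (T : I -> topologicalType) (X : topologicalType)
    (f : X -> prod_topology T) :
  (forall i, continuous (fun x => f x i)) -> continuous f.
Proof.
move=> cf x; apply/cvg_sup => i.
apply: (@continuous_comp_initial _ X _ (fun u : prod_topology T => u i) f).
exact: cf.
Qed.

Lemma prod_proj_continuous (I : eqType) (T : I -> topologicalType) i :
  continuous (fun f : prod_topology T => f i : T i).
Proof. exact: proj_continuous. Qed.

Section ReducedQuotientMap.
Variables (R : pzRingType) (V V' : lmodType R).
Variables (t : Topological V) (t' : Topological V').
Variables (B : submodClosed V) (B' : submodClosed V') (F : V -> V').
Hypothesis F_lin : linear F.
Hypothesis F_cts : continuous (F : topologized t -> topologized t').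

Lemma closure_submod_map : (forall x, x \in B -> F x \in B') ->
  forall x, x \in closure_submod t B -> F x \in closure_submod t' B'.
Proof.
move=> FB x; pose C := closure_submod t' B'.
(* Continuity sends the closure of [B] into that of [B']. To reach the span of the closure, the
   preimage of the target is shown to be a submodule. *)
pose P : {pred V} := mem [set x | F x \in C].
have F0 : F 0 = 0 by have := F_lin (-1) 0 0; rewrite scaler0 addr0 scaleN1r addNr.
have Pc : subsemimod_closed P.
  split; first split; first by apply/mem_set; rewrite /= F0; exact: rpred0.
    move=> y z /set_mem hy /set_mem hz; apply/mem_set.
    by rewrite /= -[y]scale1r F_lin scale1r; exact: rpredD.
  move=> a y /set_mem hy; apply/mem_set.
  by rewrite /= -[a *: y]addr0 F_lin F0 addr0; exact: rpredZ.
pose S : submodClosed V := HB.pack P (GRing.isSubmodClosed.Build R V P Pc).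
move=> /set_mem /(_ S) Sx; apply/set_mem/Sx => y By.
apply/mem_set; apply/mem_set => T; apply => U /F_cts /By [z [/= Bz Uz]].
by exists (F z); split => //=; exact: FB.
Qed.

Lemma quot_map_continuous (C : submodClosed V) (C' : submodClosed V') :
  (forall x, x \in C -> F x \in C') ->
  continuous (quot_map C' F :
    @quotient_topology (topologized t) (quotmod C) ->
    @quotient_topology (topologized t') (quotmod C')).
Proof.
move=> FC; apply/continuousP => A oA.
have oA' : open ((fun y : topologized t' => \pi_(quotmod C')%qT y) @^-1` A) by [].
have /continuousP/(_ _ oA') := F_cts.
rewrite [X in open X -> _](_ : _ =
  (fun y : topologized t => quot_map C' F (\pi_(quotmod C)%qT y)) @^-1` A) => [//|].
by apply/seteqP; split => y /=; rewrite quot_map_pi.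
Qed.

End ReducedQuotientMap.

Section CoefficientContinuity.
Variables (R : fieldType) (W : lmodType R) (G H : groupType) (phi : G -> H).

(* Finite sums are part of the definition so that continuity of the addition of tL'
   is never needed. *)
Definition push_continuous (L : resModule W G) (L' : resModule W H)
    (tL : Topological (elts L)) (tL' : Topological (elts L'))
    (LL' : forall f, f \in L -> pushf phi f \in L') : Prop :=
  forall (X : topologicalType) (I : Type) (s : seq I) (A : I -> set G)
    (F : I -> X -> topologized tL), (forall i, continuous (F i)) ->
  continuous (fun x => \sum_(i <- s) restrict_map LL' (rcut (A i) (F i x) : elts L)
    : topologized tL').

Definition pull_continuous (M : resModule W H) (M' : resModule W G)
    (tM : Topological (elts M)) (tM' : Topological (elts M'))
    (MM' : forall f, f \in M -> pullf phi f \in M') : Prop :=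
  forall (X : topologicalType) (I : Type) (s : seq I) (A : I -> set G)
    (F : I -> X -> topologized tM), (forall i, continuous (F i)) ->
  continuous (fun x => \sum_(i <- s) rcut (A i) (restrict_map MM' (F i x : elts M))
    : topologized tM').

Hypothesis phi_coarse : coarse_map phi.

Lemma val_sum (V : lmodType R) (S : submodClosed V) I (s : seq I) (F : I -> elts S) :
  \val (\sum_(i <- s) F i) = \sum_(i <- s) \val (F i).
Proof. exact: raddf_sum. Qed.

(** The finite support of a chain varies with the chain. The finiteness hypothesis supplies one list
    of tuples valid for all cycles, so a slice of the image is a fixed finite sum of push-forwards
    of restricted slices. *)
Lemma chain_map_continuous (L : resModule W G) (L' : resModule W H)
    (tL : Topological (elts L)) (tL' : Topological (elts L'))
    (LL' : forall f, f \in L -> pushf phi f \in L') n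
    (ZZ' : forall f, f \in cycles L n -> chain_map phi f \in cycles L' n) :
  (forall h, finite_set [set g | exists x, (@cell_map _ _ phi n (x, g)).2 = h]) ->
  push_continuous tL tL' LL' ->
  continuous (restrict_map ZZ' : topologized (cycles_topology tL n) ->
    topologized (cycles_topology tL' n)).
Proof.
move=> fin cphi; apply: pointwise_continuous => h.
have [s us sP] := finite_set_seq (fin h).
pose A g := [set x | (@cell_map _ _ phi n (x, g)).2 = h].
pose F (g : n.-tuple G) (f : topologized (cycles_topology tL n)) : topologized tL :=
  slices tL (@cycles_cochains _ _ _ L n) f g.
have cF g : continuous (F g) by exact: slices_continuous.
rewrite (_ : (fun _ => _) = fun f =>
  \sum_(g <- s) restrict_map LL' (rcut (A g) (F g f) : elts L)); first exact: cphi.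
apply/funext => f; apply: val_inj; rewrite val_sum.
rewrite /= [LHS](slice_pushf phi_coarse.1 _ us)//.
by move=> x g xg _; apply: sP; exists x.
Qed.

Lemma cochain_map_continuous (M : resModule W H) (M' : resModule W G)
    (tM : Topological (elts M)) (tM' : Topological (elts M'))
    (MM' : forall f, f \in M -> pullf phi f \in M') n
    (ZZ' : forall f, f \in cocycles M n -> cochain_map phi f \in cocycles M' n) :
  pull_continuous tM tM' MM' ->
  continuous (restrict_map ZZ' : topologized (cocycles_topology tM n) ->
    topologized (cocycles_topology tM' n)).
Proof.
move=> cphi; apply: pointwise_continuous => g.
have [s us sP] := finite_set_seq ((coarse_controlled n phi_coarse).1 g).
pose A h := [set x | (@cell_map _ _ phi n (x, g)).2 = h].
pose F (h : n.-tuple H) (f : topologized (cocycles_topology tM n)) : topologized tM :=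
  slices tM (@cocycles_cochains _ _ _ M n) f h.
have cF h : continuous (F h) by exact: slices_continuous.
rewrite (_ : (fun _ => _) = fun f =>
  \sum_(h <- s) rcut (A h) (restrict_map MM' (F h f : elts M))); first exact: cphi.
apply/funext => f; apply: val_inj; rewrite val_sum.
rewrite /= [LHS](slice_pullf (phi := phi) _ _ us)//.
by move=> x; apply: sP; exists x.
Qed.

End CoefficientContinuity.

Section TopologicalModuleMaps.
Variables (R : fieldType) (tR : Topological R) (W : lmodType R) (G : groupType).
Variables (L : resModule W G) (tL : Topological (elts L)).
Hypothesis topL : topological_resModule tR tL.

Let E := topologized tL.

Lemma sum_continuous (X : topologicalType) I (s : seq I) (F : I -> X -> E) :
  (forall i, continuous (F i)) ->
  continuous (fun x => \sum_(i <- s) (F i x : elts L) : E).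
Proof.
have [[addC _] _ _] := topL.
move=> cF; elim: s => [|i s IH].
  rewrite (_ : (fun _ => _) = fun=> 0 : elts L); first exact: cst_continuous.
  by apply/funext => x; rewrite big_nil.
rewrite (_ : (fun _ => _) =
  (fun y : E * E => (y.1 : elts L) + (y.2 : elts L) : E) \o
  (fun x => (F i x, \sum_(j <- s) (F j x : elts L) : E))).
  apply: continuous_comp_all addC => x; apply: cvg_pair; [exact: cF|exact: IH].
by apply/funext => x; rewrite big_cons.
Qed.

Lemma restrict_pushf_continuous (theta : G -> G)
    (LL : forall f, f \in L -> pushf theta f \in L) :
  close_to_id theta -> continuous (restrict_map LL : E -> E).
Proof.
have [_ cutC transC] := topL.
move=> fin; have [s us sP] := finite_set_seq fin.
rewrite (_ : restrict_map LL = fun f => \sum_(c <- s)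
  rtranslate c (rcut [set x | theta x = c * x]%g f)).
  by apply: sum_continuous => c; apply: continuous_comp_all (transC c); exact: cutC.
apply/funext => f; apply: val_inj; rewrite val_sum /=.
by rewrite (pushf_close _ us)// => x; apply: sP; exists x.
Qed.

Lemma restrict_pullf_continuous (theta : G -> G)
    (LL : forall f, f \in L -> pullf theta f \in L) :
  close_to_id theta -> continuous (restrict_map LL : E -> E).
Proof.
have [_ cutC transC] := topL.
move=> fin; have [s us sP] := finite_set_seq fin.
rewrite (_ : restrict_map LL = fun f => \sum_(c <- s)
  rcut [set x | theta x = c * x]%g (rtranslate c^-1%g f)).
  by apply: sum_continuous => c; apply: continuous_comp_all (cutC _); exact: transC.
apply/funext => f; apply: val_inj; rewrite val_sum /=.
by rewrite (pullf_close _ us)// => x; apply: sP; exists x.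
Qed.

Definition cut_piece (A : set G) (f : E) : piece tL A :=
  exist _ (rcut A f) (mem_set (ex_intro2 _ _ f I erefl)).

Lemma cut_piece_continuous A : continuous (cut_piece A).
Proof.
have [_ cutC _] := topL.
by apply: (@continuous_comp_initial _ E E set_val (cut_piece A)); exact: cutC.
Qed.

Lemma piece_val_continuous (A : set G) : continuous (fun f : piece tL A => \val f : E).
Proof. exact: initial_continuous. Qed.

End TopologicalModuleMaps.

Section Retraction.
Variables (G H : groupType) (phi : G -> H) (psi : H -> G) (X : set G).
Hypothesis close : close_to_id (psi \o phi).

(** Both [r x] and [x] are at bounded distance from $\psi(\varphi(x))$. *)
Lemma retraction_close (r : G -> G) :
  (forall x, phi (r x) = phi x) -> close_to_id r.
Proof.
move=> phir; apply: sub_finite_set (finite_image (fun p => p.1^-1 * p.2)%g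
  (finite_setX close close)) => _ [x _ <-].
exists (psi (phi (r x)) * (r x)^-1, psi (phi x) * x^-1)%g.
  by split; [exists (r x)|exists x].
by rewrite /= invgM invgK phir mulgA mulgVK.
Qed.

Lemma section_retraction : section_of phi X ->
  exists r : G -> G, (forall x, X (r x)) /\ (forall x, phi (r x) = phi x).
Proof.
move=> [_ _ surj].
have ex x : exists z, X z /\ phi z = phi x.
  by have [|z Xz zx] := surj (phi x); [exists x|exists z].
have [r rP] := choice ex.
by exists r; split=> x; have [] := rP x.
Qed.

End Retraction.

Lemma Xpart0 (G H : groupType) (phi : G -> H) (X : set G) (h : nat -> H) :
  Xpart phi X h 0 = X.
Proof.
apply/seteqP; split => x; first by case.
by move=> Xx; split => //; split; [exists x|case].
Qed.

(** * Continuity for the topologies on [push phi L] and [pull phi M] *)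

Section PushPullContinuity.
Variables (R : fieldType) (tR : Topological R) (W : lmodType R).
Variables (G H : groupType) (phi : G -> H) (psi : H -> G).
Hypotheses (phi_coarse : coarse_map phi) (psi_coarse : coarse_map psi).
Hypotheses (close_psi_phi : close_to_id (psi \o phi)).
Hypotheses (close_phi_psi : close_to_id (phi \o psi)).

Section Push.
Variables (L : resModule W G) (tL : Topological (elts L)).
Hypothesis topL : topological_resModule tR tL.
Variables (X : set G) (h : nat -> H).

(** For a map $r$ into $X$ with $\varphi r=\varphi$ one has $\varphi_*f=\varphi_*(1_X\cdot r_*f)$,
    which factors through the first map defining the topology; $r_*$ is continuous because $r$ is
    close to the identity. *)
Lemma push_topology_continuous
    (LL' : forall f, f \in L -> pushf phi f \in push phi L) :
  section_of phi X -> h 0%N = 1%g ->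
  push_continuous tL (push_topology phi tL X h) LL'.
Proof.
move=> sX h0 T I s A F cF; have [_ cutC _] := topL.
have [r [rX phir]] := section_retraction sX.
have rclose := retraction_close close_psi_phi phir.
have rL f : f \in L -> pushf r f \in L by exact: pushf_close_in.
(* The sum is formed in [L], where addition is continuous, before passing to [push phi L]. *)
pose e x : topologized tL := \sum_(i <- s) (rcut (A i) (F i x) : elts L).
have ce : continuous e.
  apply: (sum_continuous topL) => i; apply: continuous_comp_all (cF i) _.
  exact: cutC.
(* One summand suffices: at index 0 the translation is by [h 0 = 1] and [Xpart] is all of [X]. *)
pose a x : prod_topology (fun j : 'I_1 => piece tL (Xpart phi X h j)) :=
  fun j => cut_piece (Xpart phi X h j) (restrict_map rL (e x)).
have ca : continuous a.
  apply: prod_continuous => j.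
  exact: (continuous_comp_all (continuous_comp_all ce
    (restrict_pushf_continuous topL (LL := rL) rclose)) (cut_piece_continuous topL (A := Xpart phi X h j))).
rewrite (_ : (fun _ => _) = @push_sum _ _ _ _ phi L tL X h 0 \o a).
  apply: continuous_comp_all ca _.
  exact: (@final_inj_continuous _ _ _ (@push_sum _ _ _ _ phi L tL X h) 0).
apply/funext => x; apply: val_inj; rewrite /= /push_sum big_ord1 val_sum /=.
rewrite h0 translate1 Xpart0 cut_pushf (_ : r @^-1` X = setT) ?cutT; last first.
  by apply/seteqP; split => [//|y _]; exact: rX.
rewrite pushf_comp => [|y]; last first.
  apply: sub_finite_set (phi_coarse.1 y) => z [].
  by rewrite phir.
rewrite (pushf_ext _ phir) /e val_sum pushf_sum//; exact: phi_coarse.1.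
Qed.

(** On summand [j] of [push_sum], restricting and applying $\psi_*$ amounts to restricting in [L]
    and pushing along $x\mapsto\psi(h_j\varphi(x))$, which is close to the identity. *)
Lemma push_topology_inverse_continuous
    (LL' : forall f, f \in push phi L -> pushf psi f \in L) :
  push_continuous (push_topology phi tL X h) tL LL'.
Proof.
move=> T I s A F cF; have [_ cutC _] := topL.
apply: (sum_continuous topL) => i.
pose b (f : elts (push phi L)) : elts L := restrict_map LL' (rcut (A i) f).
suff cb : continuous (b : topologized (push_topology phi tL X h) -> topologized tL).
  exact: continuous_comp_all (cF i) cb.
apply: final_continuous => J.
have thetaL j f : f \in L -> pushf (fun x => psi (h j * phi x)%g) f \in L.
  by apply: pushf_close_in; exact: close_shift.
rewrite (_ : (fun _ => _) = fun f => \sum_(j < J.+1)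
  restrict_map (thetaL j) (rcut [set x | A i (h j * phi x)%g] (\val (f j) : elts L))).
  apply: (sum_continuous topL) => j.
  have cp := @prod_proj_continuous _ (fun j : 'I_J.+1 => piece tL (Xpart phi X h j)) j.
  have cv := @piece_val_continuous _ _ _ L tL (Xpart phi X h j).
  have ct := restrict_pushf_continuous topL (LL := thetaL j)
    (close_shift (h j) psi_coarse close_psi_phi).
  have cc := cutC [set x | A i (h j * phi x)%g].
  exact: (continuous_comp_all (continuous_comp_all (continuous_comp_all cp cv) cc) ct).
apply/funext => f; apply: val_inj; rewrite val_sum /= /push_sum val_sum /=.
rewrite raddf_sum pushf_sum; last exact: psi_coarse.1.
apply: eq_bigr => j _ /=.
by rewrite cut_translate_pushf//; [exact: phi_coarse.1|exact: psi_coarse.1].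
Qed.

End Push.

Section Pull.
Variables (M : resModule W H) (tM : Topological (elts M)).
Hypothesis topM : topological_resModule tR tM.
Variables (X : set G) (N : nat) (Z : 'I_N.+1 -> set G).
Variables (g : 'I_N.+1 -> G) (k : 'I_N.+1 -> H).
Hypotheses (sX : section_of phi X) (partZ : adapted_partition phi X Z g k).

(** Translation by [g i] carries the block into [X], where [phi] is injective, and the factor [k i]
    cancels. *)
Lemma adapted_inj i x y : Z i x -> Z i y -> phi x = phi y -> x = y.
Proof.
have [_ inj _] := sX; have [_ _ _ Zg] := partZ.
move=> /Zg[Xx ->] /Zg[Xy ->] /mulgI phixy.
by apply: (@mulgI _ (g i)); apply: (inj _ _ _ _ phixy); exact/mem_set.
Qed.

(** $1_A\cdot\varphi^*f=\sum_j1_{Z_j}\cdot\varphi^*(1_{\varphi(A\cap Z_j)}\cdot f)$: injectivity on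
    each block lets the restriction to $A$ be made before pulling back, so the map factors through
    [pull_sum]. *)
Lemma pull_topology_continuous
    (MM' : forall f, f \in M -> pullf phi f \in pull phi M) :
  pull_continuous tM (pull_topology phi tM Z) MM'.
Proof.
move=> T I s A F cF; have [_ cutC _] := topM.
pose e j x : topologized tM :=
  \sum_(i <- s) (rcut (phi @` (A i `&` Z j)) (F i x) : elts M).
have ce j : continuous (e j).
  apply: (sum_continuous topM) => i; apply: continuous_comp_all (cF i) _.
  exact: cutC.
pose a x : prod_topology (fun j => piece tM (phi @` Z j)) :=
  fun j => cut_piece (phi @` Z j) (e j x).
have ca : continuous a.
  apply: prod_continuous => j.
  exact: (continuous_comp_all (ce j) (cut_piece_continuous topM (A := phi @` Z j))).
rewrite (_ : (fun _ => _) = @pull_sum _ _ _ _ phi M tM N Z \o a).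
  apply: continuous_comp_all ca _.
  exact: (@final_inj_continuous unit _ _ (fun=> @pull_sum _ _ _ _ phi M tM N Z) tt).
have [trivZ coverZ _ _] := partZ.
apply/funext => x; apply: val_inj; rewrite /= /pull_sum !val_sum /=.
rewrite !fct_sumE; apply/funext => y.
have [j _ Zjy] : (\bigcup_i Z i) y by rewrite coverZ.
rewrite [RHS](bigD1 j)//= [X in _ + X]big1 ?addr0; last first.
  move=> j' j'j; rewrite cutE ifF//; apply/negP => /set_mem Zj'y.
  have jj' : j' = j by apply: trivZ => //; exists y.
  by rewrite jj' eqxx in j'j.
rewrite [RHS]cutE ifT; last exact/mem_set.
rewrite [RHS]/pullf /= [RHS]cutE ifT; last by apply/mem_set; exists y.
rewrite /e val_sum fct_sumE; apply: eq_bigr => i _; rewrite /= !cutE.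
suff -> : (y \in A i) = (phi y \in phi @` (A i `&` Z j)) by [].
apply/idP/idP => /set_mem Ay; apply/mem_set; first by exists y.
by case: Ay => z [Az Zjz] /(adapted_inj Zjz Zjy) <-.
Qed.

(** After [pull_sum], summand [j] is pulled back along $\varphi\psi$, which is close to the
    identity, and restricted to $\psi^{-1}(Z_j)$. *)
Lemma pull_topology_inverse_continuous
    (MM' : forall f, f \in pull phi M -> pullf psi f \in M) :
  pull_continuous (pull_topology phi tM Z) tM MM'.
Proof.
move=> T I s A F cF; have [_ cutC _] := topM.
apply: (sum_continuous topM) => i.
apply: (@continuous_comp_all _ (topologized tM)); last exact: cutC.
pose b (f : elts (pull phi M)) : elts M := restrict_map MM' f.
suff cb : continuous (b : topologized (pull_topology phi tM Z) -> topologized tM).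
  exact: continuous_comp_all (cF i) cb.
apply: final_continuous => _.
have thetaM f : f \in M -> pullf (phi \o psi) f \in M by exact: pullf_close_in.
rewrite (_ : (fun _ => _) = fun f => \sum_(j < N.+1)
  rcut (psi @^-1` Z j) (restrict_map thetaM (\val (f j) : elts M))).
  apply: (sum_continuous topM) => j.
  have cp := @prod_proj_continuous _ (fun j : 'I_N.+1 => piece tM (phi @` Z j)) j.
  have cv := @piece_val_continuous _ _ _ M tM (phi @` Z j).
  have ct := restrict_pullf_continuous topM (LL := thetaM) close_phi_psi.
  have cc := cutC (psi @^-1` Z j).
  exact: (continuous_comp_all (continuous_comp_all (continuous_comp_all cp cv) ct) cc).
apply/funext => f; apply: val_inj; rewrite val_sum /= /pull_sum val_sum /=.
by rewrite raddf_sum.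
Qed.

End Pull.
End PushPullContinuity.

(** * Inverse maps induced by a coarse inverse *)

(** For consecutive vertices $y,z$, the entry $yz^{-1}$ is the inverse displacement of $y$ under
    $\psi\varphi$, times $\psi\varphi(y)\psi\varphi(z)^{-1}$, times the displacement of $z$. The
    tuple [h] bounds the middle factor, independently of the base point. *)
Lemma coarse_inverse_tuples (G H : groupType) (phi : G -> H) (psi : H -> G) n
    (h : n.-tuple H) : coarse_map psi -> close_to_id (psi \o phi) ->
  finite_set [set g | exists x, (@cell_map _ _ phi n (x, g)).2 = h].
Proof.
move=> [_ cpsi] close; pose S := [set s : H * H | (s.1 * s.2^-1)%g \in (h : seq H)].
have finS : finite_set [set (s.1 * s.2^-1)%g | s in S].
  by apply: sub_finite_set (finite_seq h) => _ [s Ss <-].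
pose D := range (fun x => psi (phi x) * x^-1)%g.
pose F := [set (p.1.1^-1 * p.1.2 * p.2)%g |
  p in D `*` [set (psi s.1 * (psi s.2)^-1)%g | s in S] `*` D].
have finF : finite_set F.
  exact: (finite_image _ (finite_setX (finite_setX close (cpsi _ finS)) close)).
apply: sub_finite_set (finite_tuples n finF) => g [x hE] i.
pose y := vert (x, g) i; pose z := vert (x, g) i.+1.
exists (psi (phi y) * y^-1, psi (phi y) * (psi (phi z))^-1, psi (phi z) * z^-1)%g.
  split; [split|]; [by exists y| |by exists z].
  exists (phi y, phi z) => //; rewrite /S /= -hE cell_mapE.
  by apply/tnthP; exists i; rewrite tnth_mktuple.
rewrite /= invgM invgK !mulgA !mulgVK.
by rewrite div_vert (tnth_nth 1%g).
Qed.

Lemma linear_map_of (R : pzRingType) (U V : lmodType R) (f : U -> V) :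
  linear f -> exists g : {linear U -> V}, g = f :> (U -> V).
Proof.
move=> lin; pose g : {linear U -> V} := HB.pack f (GRing.isLinear.Build R U V _ f lin).
by exists g.
Qed.

Section MapsCompose.
Variables (R : pzRingType) (W : lmodType R) (G H : groupType).
Variables (phi : G -> H) (psi : H -> G).

Lemma chain_map_comp n (f : cell G n -> W) :
  finite_to_one phi -> finite_to_one psi ->
  chain_map psi (chain_map phi f) = chain_map (psi \o phi) f.
Proof.
move=> fphi fpsi; rewrite /chain_map pushf_comp => [|y].
  by apply: pushf_ext => p; exact: cell_map_comp.
apply: sub_finite_set (bigcup_finite (cell_map_finite_to_one (n := n) fpsi y)
  (fun q _ => cell_map_finite_to_one (n := n) fphi q)).
by move=> p [pE _]; exists (cell_map phi p).
Qed.

Lemma cochain_map_comp n (f : cell G n -> W) :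
  cochain_map phi (cochain_map psi f) = cochain_map (psi \o phi) f.
Proof.
by apply/funext => p; rewrite /cochain_map /pullf /= cell_map_comp.
Qed.

Lemma chain_map_linear n : finite_to_one phi -> linear (@chain_map G H phi R W n).
Proof.
move=> fphi; apply: pushf_linear_finite; exact: cell_map_finite_to_one.
Qed.

Lemma cochain_map_linear n : linear (@cochain_map G H phi R W n).
Proof. by []. Qed.

End MapsCompose.

Section InverseMaps.
Variables (R : pzRingType) (V V' : lmodType R).
Variables (Z : submodClosed V) (Z' : submodClosed V').
Variables (F : V -> V') (F' : V' -> V).
Hypotheses (F_lin : linear F) (F'_lin : linear F').
Hypotheses (FZ : forall f, f \in Z -> F f \in Z') (F'Z : forall f, f \in Z' -> F' f \in Z).

Lemma quot_iso (B : submodClosed (elts Z)) (B' : submodClosed (elts Z')) :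
  (forall z, z \in B -> restrict_map FZ z \in B') ->
  (forall z, z \in B' -> restrict_map F'Z z \in B) ->
  (forall z, restrict_map F'Z (restrict_map FZ z) - z \in B) ->
  (forall z, restrict_map FZ (restrict_map F'Z z) - z \in B') ->
  exists f : {linear quotmod B -> quotmod B'},
    bijective f /\ induced_by (B := B) (B' := B') F f.
Proof.
move=> FB F'B FK F'K.
have [f fE] := linear_map_of (quot_map_linear (restrict_map_linear FZ F_lin) FB).
exists f; rewrite fE; split; last exact: induced_quot_map.
exists (quot_map B (restrict_map F'Z)).
  by apply: quot_mapK => //; exact: restrict_map_linear.
by apply: quot_mapK => //; exact: restrict_map_linear.
Qed.

Lemma quot_homeomorphism (t : Topological (elts Z)) (t' : Topological (elts Z'))
    (B : submodClosed (elts Z)) (B' : submodClosed (elts Z')) :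
  continuous (restrict_map FZ : topologized t -> topologized t') ->
  continuous (restrict_map F'Z : topologized t' -> topologized t) ->
  (forall z, z \in B -> restrict_map FZ z \in B') ->
  (forall z, z \in B' -> restrict_map F'Z z \in B) ->
  (forall z, restrict_map F'Z (restrict_map FZ z) - z \in B) ->
  (forall z, restrict_map FZ (restrict_map F'Z z) - z \in B') ->
  exists f : {linear quotmod (closure_submod t B) -> quotmod (closure_submod t' B')},
    homeomorphism (f : topologized (quotient_class t B) ->
      topologized (quotient_class t' B')) /\
    induced_by (B := closure_submod t B) (B' := closure_submod t' B') F f.
Proof.
move=> cF cF' FB F'B FK F'K.
have rF := restrict_map_linear FZ F_lin; have rF' := restrict_map_linear F'Z F'_lin.
have cFB := closure_submod_map rF cF FB.
have cF'B := closure_submod_map rF' cF' F'B.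
(* The maps are mutually inverse modulo [B] and [B'], hence also modulo the closures. *)
have sub (U : lmodType R) (u : Topological U) (C : submodClosed U) x :
    x \in C -> x \in closure_submod u C.
  by move=> Cx; apply/mem_set => S; apply; exact: subset_closure.
have [f fE] := linear_map_of (quot_map_linear rF cFB).
exists f; rewrite fE; split; last exact: induced_quot_map.
exists (quot_map (closure_submod t B) (restrict_map F'Z)); split.
- by apply: quot_mapK => // z; exact: sub.
- by apply: quot_mapK => // z; exact: sub.
- exact: quot_map_continuous.
- exact: quot_map_continuous.
Qed.

End InverseMaps.

Section InversePair.
Variables (R : pzRingType) (W : lmodType R) (G H : groupType).
Variables (phi : G -> H) (psi : H -> G).
Hypotheses (phi_coarse : coarse_map phi) (psi_coarse : coarse_map psi).
Hypothesis close : close_to_id (psi \o phi).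

Lemma chain_map_inverse (L : resModule W G) (L' : resModule W H)
    (LL' : forall f, f \in L -> pushf phi f \in L')
    (L'L : forall f, f \in L' -> pushf psi f \in L) n (z : elts (cycles L n)) :
  restrict_map (@chain_map_cycles _ _ _ _ _ psi_coarse _ _ L'L n)
    (restrict_map (@chain_map_cycles _ _ _ _ _ phi_coarse _ _ LL' n) z) - z
  \in within_submod (cycles L n) (boundaries L n).
Proof.
suff : chain_map psi (chain_map phi (\val z)) - \val z \in boundaries L n by [].
rewrite chain_map_comp; [|exact: phi_coarse.1|exact: psi_coarse.1].
exact: chain_homotopy (valP z).
Qed.

Lemma cochain_map_inverse (M : resModule W G) (M' : resModule W H)
    (M'M : forall f, f \in M' -> pullf phi f \in M)
    (MM' : forall f, f \in M -> pullf psi f \in M') n (z : elts (cocycles M n)) :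
  restrict_map (@cochain_map_cocycles _ _ _ _ _ phi_coarse _ _ M'M n)
    (restrict_map (@cochain_map_cocycles _ _ _ _ _ psi_coarse _ _ MM' n) z) - z
  \in within_submod (cocycles M n) (coboundaries M n).
Proof.
suff : cochain_map phi (cochain_map psi (\val z)) - \val z \in coboundaries M n by [].
rewrite cochain_map_comp.
exact: cochain_homotopy (valP z).
Qed.

End InversePair.

(** * The four isomorphisms from a coarse inverse *)

Theorem corollary4p39 (G H : groupType)
    (countG : countable [set: G]) (countH : countable [set: H])
    (phi : G -> H) (phi_ce : coarse_equivalence phi) :
  (forall (R : comPzRingType) (W : lmodType R)
      (L : resModule W G) (M : resModule W H) (n : nat),
    (exists f : {linear homology L n -> homology (push phi L) n},
       bijective f /\ induced_by (@chain_map G H phi R W n) f) /\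
    (exists f : {linear cohomology M n -> cohomology (pull phi M) n},
       bijective f /\ induced_by (@cochain_map G H phi R W n) f)) /\
  (forall (R : fieldType) (tR : Topological R) (W : lmodType R)
      (L : resModule W G) (M : resModule W H)
      (tL : Topological (elts L)) (tM : Topological (elts M))
      (X : set G) (h : nat -> H)
      (N : nat) (Z : 'I_N.+1 -> set G) (g : 'I_N.+1 -> G) (k : 'I_N.+1 -> H),
    topological_field tR ->
    topological_resModule tR tL -> topological_resModule tR tM ->
    section_of phi X -> enumeration h -> adapted_partition phi X Z g k ->
    forall n : nat,
    let tpushL := push_topology phi tL X h in
    let tpullM := pull_topology phi tM Z in
    (exists f : {linear reduced_homology tL n -> reduced_homology tpushL n},
       homeomorphism (f : topologized (reduced_homology_topology tL n) ->
                          topologized (reduced_homology_topology tpushL n)) /\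
       induced_by (@chain_map G H phi R W n) f) /\
    (exists f : {linear reduced_cohomology tM n -> reduced_cohomology tpullM n},
       homeomorphism (f : topologized (reduced_cohomology_topology tM n) ->
                          topologized (reduced_cohomology_topology tpullM n)) /\
       induced_by (@cochain_map G H phi R W n) f)).
Proof.
have [phi_coarse [psi [psi_coarse psi_phi phi_psi]]] := phi_ce.
have phi_lin (R : pzRingType) (W : lmodType R) n :=
  @chain_map_linear R W G H phi n phi_coarse.1.
have psi_lin (R : pzRingType) (W : lmodType R) n :=
  @chain_map_linear R W H G psi n psi_coarse.1.
have phi_colin (R : pzRingType) (W : lmodType R) n :=
  @cochain_map_linear R W G H phi n.
have psi_colin (R : pzRingType) (W : lmodType R) n :=
  @cochain_map_linear R W H G psi n.
pose LL' (R : pzRingType) (W : lmodType R) (L : resModule W G) :=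
  @pushf_in R W G H phi L.
have L'L (R : pzRingType) (W : lmodType R) (L : resModule W G) f :
    f \in push phi L -> pushf psi f \in L.
  exact: (pushf_push_in phi_coarse psi_coarse).
pose MM' (R : pzRingType) (W : lmodType R) (M : resModule W H) :=
  @pullf_in R W G H phi M.
have M'M (R : pzRingType) (W : lmodType R) (M : resModule W H) f :
    f \in pull phi M -> pullf psi f \in M.
  exact: (pullf_pull_in phi_coarse).
have FB (R : pzRingType) (W : lmodType R) (L : resModule W G) n f :=
  @chain_map_boundaries R W _ _ phi phi_coarse _ _ (@LL' R W L) n f.
have F'B (R : pzRingType) (W : lmodType R) (L : resModule W G) n f :=
  @chain_map_boundaries R W _ _ psi psi_coarse _ _ (@L'L R W L) n f.
have CB (R : pzRingType) (W : lmodType R) (M : resModule W H) n f :=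
  @cochain_map_coboundaries R W _ _ phi phi_coarse _ _ (@MM' R W M) n f.
have C'B (R : pzRingType) (W : lmodType R) (M : resModule W H) n f :=
  @cochain_map_coboundaries R W _ _ psi psi_coarse _ _ (@M'M R W M) n f.
pose FZ (R : pzRingType) (W : lmodType R) (L : resModule W G) n :=
  @chain_map_cycles R W _ _ phi phi_coarse _ _ (@LL' R W L) n.
pose F'Z (R : pzRingType) (W : lmodType R) (L : resModule W G) n :=
  @chain_map_cycles R W _ _ psi psi_coarse _ _ (@L'L R W L) n.
pose CZ (R : pzRingType) (W : lmodType R) (M : resModule W H) n :=
  @cochain_map_cocycles R W _ _ phi phi_coarse _ _ (@MM' R W M) n.
pose C'Z (R : pzRingType) (W : lmodType R) (M : resModule W H) n :=
  @cochain_map_cocycles R W _ _ psi psi_coarse _ _ (@M'M R W M) n.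
split=> [R W L M n|R tR W L M tL tM X h N Z g k _ topL topM sX [h0 _] partZ n /=].
  split.
    apply: (quot_iso (phi_lin R W n) (psi_lin R W n) (FZ := FZ R W L n)
      (F'Z := F'Z R W L n)) => [z Bz|z Bz|z|z].
    - exact: FB.
    - exact: F'B.
    - exact: chain_map_inverse.
    - exact: chain_map_inverse.
  apply: (quot_iso (phi_colin R W n) (psi_colin R W n) (FZ := CZ R W M n)
    (F'Z := C'Z R W M n)) => [z Bz|z Bz|z|z].
  - exact: CB.
  - exact: C'B.
  - exact: cochain_map_inverse.
  - exact: cochain_map_inverse.
split.
  apply: (quot_homeomorphism (phi_lin R W n) (psi_lin R W n) (FZ := FZ R W L n)
    (F'Z := F'Z R W L n)) => [||z Bz|z Bz|z|z].
  - apply: (chain_map_continuous phi_coarse (LL' := @LL' R W L)).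
      by move=> t; exact: (coarse_inverse_tuples t psi_coarse psi_phi).
    exact: (push_topology_continuous phi_coarse psi_phi topL sX h0).
  - apply: (chain_map_continuous psi_coarse (LL' := @L'L R W L)).
      (* The uniform bound is now needed for [psi], so [phi] serves as its coarse inverse. *)
      by move=> t; exact: (coarse_inverse_tuples t phi_coarse phi_psi).
    exact: (push_topology_inverse_continuous phi_coarse psi_coarse psi_phi topL).
  - exact: FB.
  - exact: F'B.
  - exact: chain_map_inverse.
  - exact: chain_map_inverse.
apply: (quot_homeomorphism (phi_colin R W n) (psi_colin R W n) (FZ := CZ R W M n)
  (F'Z := C'Z R W M n)) => [||z Bz|z Bz|z|z].
- apply: (cochain_map_continuous phi_coarse (MM' := @MM' R W M)).
  exact: (pull_topology_continuous topM sX partZ).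
- apply: (cochain_map_continuous psi_coarse (MM' := @M'M R W M)).
  exact: (pull_topology_inverse_continuous phi_psi topM).
- exact: CB.
- exact: C'B.
- exact: cochain_map_inverse.
- exact: cochain_map_inverse.
Qed.
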